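(* For every $N \in \{1, 2, \ldots, +\infty\}$ there exists a closed (in the norm topology) shift invariant subspace $E_N \subset \mathcal{B}$ of the Bloch space such that $\operatorname{ind}(E_N) = N$.
   Context: Let $\mathbb{D}=\{z\in\mathbb{C}: |z|<1\}$. The Bloch space $\mathcal{B}$ is the Banach space of functions $f$ analytic in $\mathbb{D}$ with $\sup_{|z|<1}(1-|z|^2)|f'(z)|<+\infty$, with norm $\|f\|_{\mathcal{B}} = |f(0)|+\sup_{|z|<1}(1-|z|^2)|f'(z)|$. The shift operator is $M_z:\mathcal{B}\to\mathcal{B}$, $(M_zf)(z)=zf(z)$; it is bounded and bounded below. A (closed) invariant subspace is a norm-closed linear subspace $E\subset\mathcal{B}$ with $zE:=M_zE\subset E$; then $zE$ is closed. The index of $E$ is $\operatorname{ind}(E)=\dim(E/zE)$; $\operatorname{ind}(E)=+\infty$ means that $E/zE$ is infinite-dimensional. *)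

(* Defs.v *)
From HB Require Import structures.
From mathcomp Require Import all_boot all_order all_algebra complex.
From mathcomp Require Import all_classical all_reals all_analysis.
From mathcomp Require Import ring.

Set Implicit Arguments.
Unset Strict Implicit.
Unset Printing Implicit Defensive.

Import Order.TTheory GRing.Theory Num.Theory numFieldNormedType.Exports.
Import ComplexField.Normc.

Local Open Scope classical_set_scope.
Local Open Scope ring_scope.
Local Open Scope complex_scope.

(* The topology of [R[i]], and differentiability of maps [R[i] -> R[i]] over
   the field [R[i]] (that is, complex differentiability), come from viewing the
   numeric field [R[i]] as a normed module over itself. *)
HB.instance Definition _ (R : rcfType) := NormedModule.copy R[i] R[i]^o.

Section complex_functions.
Variable R : realType.
Local Notation C := R[i].
Local Notation Re := (@complex.Re R).
Implicit Types (f g : C -> C) (z w : C).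

Lemma normC_normc z : `|z| = (normc z)%:C. Proof. by []. Qed.

Lemma normc_ge0 z : 0 <= normc z.
Proof. by rewrite -lecR -normC_normc normr_ge0. Qed.

Lemma ler_normcD z w : normc (z + w) <= normc z + normc w.
Proof. exact: le_normcD. Qed.

Lemma normc_real (x : R) : normc x%:C = `|x|.
Proof. by rewrite /= expr0n/= addr0 sqrtr_sqr. Qed.

Lemma Re_le_normc z : Re z <= normc z.
Proof.
case: z => a b /=; rewrite (le_trans (ler_norm _))// -sqrtr_sqr.
by rewrite ler_wsqrtr// lerDl sqr_ge0.
Qed.

Lemma normc_lt1 z : (`|z| < 1) = (normc z < 1).
Proof. by rewrite normC_normc -[1 in LHS]/(1%:C) ltcR. Qed.

Lemma is_derive_Re_ray f (u z : C) (t : R) : z != 0 ->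
  derivable f (t%:C * z) 1 ->
  is_derive t 1 (fun s : R => Re (u * f (s%:C * z)))
    (Re (u * z * derive1 f (t%:C * z))).
Proof.
move=> z0 df; set d := derive1 f (t%:C * z).
have Hf : h^-1 *: (f (h *: 1 + t%:C * z) - f (t%:C * z)) @[h --> 0^'] --> d.
  by rewrite /d derive1E; exact: df.
have Hs : (fun s : R => s%:C * z) @ 0^' --> (0 : C)^'.
  move=> A /=; rewrite /dnbhs /within/= => /nbhs_ballP[e e0 eA].
  have : 0 < e := e0; rewrite ltcE/= => /andP[/eqP ie e1].
  have nz0 : 0 < normc z.
    by rewrite lt_def normc_ge0 andbT; apply: contra z0 => /eqP/eq0_normc ->.
  apply/nbhs_ballP; exists (Re e / normc z); first by rewrite /= divr_gt0.
  move=> s; rewrite /ball/= sub0r normrN => se s0; apply: eA.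
    rewrite /ball/= sub0r normrN normC_normc normcM normc_real.
    by rewrite ltcE/= ie eqxx/= -ltr_pdivlMr.
  by rewrite mulf_neq0// -[0]/(0%:C) (inj_eq (@complexI R)).
have Hr : Re (u * z * x) @[x --> d] --> Re (u * z * d).
  apply/(@cvgrPdist_lt R R C (nbhs d) _) => e e0.
  have K0 : 0 < normc (u * z) + 1 by rewrite ltr_wpDl// normc_ge0.
  have : \forall x \near nbhs d, `|d - x| < (e / (normc (u * z) + 1))%:C.
    apply/nbhs_ballP; exists (e / (normc (u * z) + 1))%:C => //=.
    by rewrite -[0]/(0%:C) ltcR divr_gt0.
  apply: filterS => x; rewrite normC_normc ltcR ltr_pdivlMr// => dx.
  rewrite (_ : _ - _ = Re (u * z * (d - x))); last first.
    by rewrite mulrBr raddfB.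
  rewrite ltr_norml; apply/andP; split.
    rewrite ltrNl -raddfN/= (le_lt_trans (Re_le_normc _))// normcN normcM.
    rewrite (le_lt_trans _ dx)// mulrC ler_wpM2l ?normc_ge0//.
    by rewrite lerDl.
  rewrite (le_lt_trans (Re_le_normc _))// normcM.
  rewrite (le_lt_trans _ dx)// mulrC ler_wpM2l ?normc_ge0//.
  by rewrite lerDl.
have Hh : h^-1 *: (Re (u * f ((h *: 1 + t)%:C * z)) - Re (u * f (t%:C * z)))
    @[h --> 0^'] --> Re (u * z * d).
  have := cvg_comp _ _ (cvg_comp _ _ Hs Hf) Hr.
  apply: cvg_trans; apply: near_eq_cvg; near=> h.
  have h0 : h != 0 by near: h; exact: nbhs_dnbhs_neq.
  rewrite /= [h *: 1](mulr1 h) [_%:A](mulr1 (h%:C * z)).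
  rewrite -!raddfB/= -mulrBr.
  have -> : (h + t)%:C * z = h%:C * z + t%:C * z by rewrite rmorphD mulrDl.
  set D := f _ - f _.
  have -> : h^-1 *: Re (u * D) = Re ((h^-1)%:C * (u * D)).
    by case: (u * D) => a b /=; rewrite mul0r subr0.
  have hC0 : h%:C != 0 by rewrite -[0]/(0%:C) (inj_eq (@complexI R)).
  congr Re; rewrite -[_ *: D]/((h%:C * z)^-1 * D) fmorphV.
  by field; rewrite hC0 z0.
split; first by apply/cvg_ex; eexists; exact: Hh.
exact: (cvg_lim _ Hh).
Unshelve. all: by end_near. Qed.

Lemma disc_mean_value f z (M : R) : `|z| < 1 ->
  (forall w, `|w| < 1 -> derivable f w 1) ->
  (forall w, `|w| <= `|z| -> normc (derive1 f w) <= M) ->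
  normc (f z - f 0) <= M.
Proof.
move=> z1 df dM.
have M0 : 0 <= M.
  by apply: (le_trans (normc_ge0 (derive1 f z))); exact: dM.
have [->|z0] := eqVneq z 0; first by rewrite subrr normc0.
have seg (t : R) : t \in `[0, 1] -> `|t%:C * z| <= `|z|.
  rewrite in_itv/= => /andP[t0 t1]; rewrite normrM ler_piMl// normC_normc.
  by rewrite -[1]/(1%:C) lecR normc_real ger0_norm.
set D := f z - f 0; set u := D^*%C.
have dh (t : R) : t \in `[0, 1] -> is_derive t 1
    (fun s : R => Re (u * f (s%:C * z))) (Re (u * z * derive1 f (t%:C * z))).
  move=> t01; apply: is_derive_Re_ray => //.
  by apply: df; rewrite (le_lt_trans (seg _ _)).
have sub (t : R) : t \in `]0, 1[ -> t \in `[0, 1].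
  by rewrite !in_itv/= => /andP[t0 t1]; rewrite !ltW.
have cont : {within `[0, 1],
    continuous (fun s : R => Re (u * f (s%:C * z)))}.
  by apply: derivable_within_continuous => t /dh [].
have [c c01] := MVT_segment ler01 (fun t tI => dh t (sub t tI)) cont.
rewrite /= subr0 mulr1 mul1r mul0r -raddfB/= -mulrBr -/D => E.
have uD : Re (u * D) = normc D ^+ 2.
  rewrite /u; case: (D) => a b /=.
  by rewrite sqr_sqrtr ?addr_ge0 ?sqr_ge0// mulNr opprK -!expr2.
have nu : normc u = normc D by rewrite /u; case: (D) => a b /=; rewrite sqrrN.
have [->|D0] := eqVneq (normc D) 0; first by [].
have D0' : 0 < normc D by rewrite lt_def D0 normc_ge0.
rewrite -(ler_pM2l D0') -expr2 -uD E (le_trans (Re_le_normc _))//.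
rewrite !normcM nu -mulrA ler_wpM2l ?normc_ge0//.
rewrite -[leRHS]mul1r ler_pM ?normc_ge0//.
  by rewrite ltW// -normc_lt1.
exact/dM/seg.
Qed.

End complex_functions.

Section bloch_space.
Variable R : realType.
Local Notation C := R[i].
Implicit Types (f g : C -> C) (z w : C).

Definition bloch_weight f z : R := (1 - normc z ^+ 2) * normc (derive1 f z).

Definition bloch_values f : set R :=
  [set bloch_weight f z | z in [set z | `|z| < 1]].

(* A function on the open unit disc is represented by its extension by 0 to the
   whole plane, so that equality of functions on the disc is Leibniz equality;
   the extension does not affect derivatives at points of the (open) disc. *)
Definition is_bloch f : Prop :=
  [/\ forall z, 1 <= `|z| -> f z = 0,
      forall z, `|z| < 1 -> derivable f z 1
    & has_ubound (bloch_values f)].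

Definition bloch_pred : {pred C -> C} := [pred f | `[< is_bloch f >]].

Record bloch := Bloch { bloch_fun :> C -> C; _ : bloch_fun \in bloch_pred }.

HB.instance Definition _ := [isSub for bloch_fun].
HB.instance Definition _ := [Choice of bloch by <:].

Lemma blochP (f : bloch) : is_bloch f.
Proof. by case: f => f /= /asboolP. Qed.

Lemma bloch_weight_ge0 f z : `|z| < 1 -> 0 <= bloch_weight f z.
Proof.
rewrite normc_lt1 => z1; rewrite mulr_ge0 ?normc_ge0// subr_ge0.
by rewrite expr_le1 ?normc_ge0// ltW.
Qed.

Lemma bloch_values_neq0 f : bloch_values f !=set0.
Proof. by exists (bloch_weight f 0), 0 => //=; rewrite normr0. Qed.

Lemma bloch_weightD f g z : `|z| < 1 -> derivable f z 1 -> derivable g z 1 ->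
  bloch_weight (f + g) z <= bloch_weight f z + bloch_weight g z.
Proof.
rewrite normc_lt1 => z1 df dg.
have dfg : derive1 (f + g) z = derive1 f z + derive1 g z.
  by rewrite !derive1E; exact (deriveD df dg).
rewrite /bloch_weight dfg -mulrDr ler_wpM2l ?ler_normcD//.
by rewrite subr_ge0 expr_le1 ?normc_ge0// ltW.
Qed.

Lemma bloch_weightZ (a : C) f z : derivable f z 1 ->
  bloch_weight (a *: f) z = normc a * bloch_weight f z.
Proof.
move=> df; have daf : derive1 (a *: f) z = a * derive1 f z.
  by rewrite !derive1E; exact (deriveZ a df).
by rewrite /bloch_weight daf normcM mulrCA.
Qed.

Lemma bloch_submod_closed : submod_closed bloch_pred.
Proof.
split.
  apply/asboolP; split => //.
  exists 0 => _ [z /= z1 <-].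
  have d0 : derive1 (0 : C -> C) z = 0.
    by rewrite derive1E; exact (derive_cst (0 : C) z 1).
  by rewrite /bloch_weight d0 normc0 mulr0.
move=> a f g /asboolP[f0 df [x fx]] /asboolP[g0 dg [y gy]].
apply/asboolP; split => [z z1|z z1|].
- by rewrite !fctE f0// g0// scaler0 addr0.
- by have := derivableD (@derivableZ C C C f a z 1 (df z z1)) (dg z z1); apply.
- exists (normc a * x + y) => _ [z /= z1 <-].
  have dfz := df _ z1; have dgz := dg _ z1.
  rewrite (le_trans (bloch_weightD z1 (@derivableZ C C C f a z 1 dfz) dgz))//.
  rewrite bloch_weightZ// lerD//; last by apply: gy; exists z.
  by rewrite ler_wpM2l ?normc_ge0//; apply: fx; exists z.
Qed.

HB.instance Definition _ :=
  GRing.isSubmodClosed.Build _ _ bloch_pred bloch_submod_closed.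
HB.instance Definition _ := [SubChoice_isSubLmodule of bloch by <:].

Definition bloch_norm (f : bloch) : R := normc (f 0) + sup (bloch_values f).

Lemma bloch_has_sup (f : bloch) : has_sup (bloch_values f).
Proof. by split; [exact: bloch_values_neq0|case: (blochP f)]. Qed.

Lemma bloch_weight_le_sup (f : bloch) z : `|z| < 1 ->
  bloch_weight f z <= sup (bloch_values f).
Proof. by move=> z1; apply: ub_le_sup; [case: (bloch_has_sup f)|exists z]. Qed.

Lemma bloch_sup_ge0 (f : bloch) : 0 <= sup (bloch_values f).
Proof.
have z1 : `|0 : C| < 1 by rewrite normr0.
exact: le_trans (bloch_weight_ge0 f z1) (bloch_weight_le_sup f z1).
Qed.

Lemma bloch_derivable (f : bloch) z : `|z| < 1 -> derivable f z 1.
Proof. by case: (blochP f) => _ df _; exact: df. Qed.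

Lemma bloch_normD (f g : bloch) :
  bloch_norm (f + g) <= bloch_norm f + bloch_norm g.
Proof.
rewrite /bloch_norm addrACA lerD ?ler_normcD//.
apply: ge_sup; first exact: bloch_values_neq0.
move=> _ [z /= z1 <-].
have dfz := @bloch_derivable f z z1; have dgz := @bloch_derivable g z z1.
apply: le_trans (bloch_weightD z1 dfz dgz) _.
by rewrite lerD// bloch_weight_le_sup.
Qed.

Lemma bloch_sup_Zle (a : C) (f : bloch) :
  sup (bloch_values (a *: f : bloch)) <= normc a * sup (bloch_values f).
Proof.
apply: ge_sup; first exact: bloch_values_neq0.
move=> _ [z /= z1 <-].
have -> : bloch_weight (a *: f : bloch) z = normc a * bloch_weight f z.
  exact: (bloch_weightZ a (@bloch_derivable f z z1)).
by rewrite ler_wpM2l ?normc_ge0//; exact: bloch_weight_le_sup.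
Qed.

Lemma bloch_normZ (a : C) (f : bloch) :
  bloch_norm (a *: f) = normc a * bloch_norm f.
Proof.
rewrite /bloch_norm mulrDr normcM; congr (_ + _).
apply/eqP; rewrite eq_le bloch_sup_Zle/=.
have [->|a0] := eqVneq a 0.
  rewrite (@normc0 R) mul0r.
  exact: (bloch_sup_ge0 (0 *: f)).
have na0 : 0 < normc a.
  by rewrite lt_def normc_ge0 andbT; apply: contra a0 => /eqP/eq0_normc ->.
rewrite -ler_pdivlMl// -normcV -{1}[f](scalerK a0).
exact: bloch_sup_Zle.
Qed.

Lemma bloch_growth (f : bloch) z : `|z| < 1 ->
  (1 - normc z ^+ 2) * normc (f z - f 0) <= sup (bloch_values f).
Proof.
move=> z1; have := z1; rewrite normc_lt1 => nz1.
have pz : 0 < 1 - normc z ^+ 2 by rewrite subr_gt0 exprn_ilt1 ?normc_ge0.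
rewrite mulrC -ler_pdivlMr//.
apply: disc_mean_value => // [w w1|w]; first exact: bloch_derivable.
rewrite !normC_normc lecR => wz; rewrite ler_pdivlMr// mulrC.
have w1 : `|w| < 1 by rewrite normc_lt1 (le_lt_trans wz).
apply: le_trans (bloch_weight_le_sup f w1).
by rewrite ler_wpM2r ?normc_ge0// lerB// lerXn2r ?nnegrE ?normc_ge0.
Qed.

Lemma bloch_norm_eq0 (f : bloch) : bloch_norm f = 0 -> f = 0.
Proof.
move=> /eqP; rewrite paddr_eq0 ?normc_ge0 ?bloch_sup_ge0//.
move=> /andP[/eqP/eq0_normc f0 /eqP s0].
apply/val_inj/funext => z /=; have [z1|z1] := boolP (`|z| < 1); last first.
  case: (blochP f) => -> //; move: z1; rewrite !normC_normc.
  by rewrite -[1]/(1%:C) ltcR lecR -leNgt.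
have := bloch_growth f z1; rewrite f0 subr0 s0.
have pz : 0 < 1 - normc z ^+ 2.
  by rewrite subr_gt0 exprn_ilt1 ?normc_ge0// -normc_lt1.
rewrite pmulr_rle0// => nf; apply/eq0_normc/eqP.
by rewrite eq_le nf normc_ge0.
Qed.

Lemma bloch_normC_normD (f g : bloch) :
  (bloch_norm (f + g))%:C <= (bloch_norm f)%:C + (bloch_norm g)%:C.
Proof. by rewrite -rmorphD lecR bloch_normD. Qed.

Lemma bloch_normC_normZ (a : C) (f : bloch) :
  (bloch_norm (a *: f))%:C = `|a| * (bloch_norm f)%:C.
Proof. by rewrite bloch_normZ rmorphM. Qed.

Lemma bloch_normC_eq0 (f : bloch) : (bloch_norm f)%:C = 0 -> f = 0.
Proof. by move=> /complexI/bloch_norm_eq0. Qed.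

(* The norm of a normed module over [R[i]] takes its values in [R[i]]. *)
HB.instance Definition _ := @Lmodule_isNormed.Build C bloch
  (fun f : bloch => (bloch_norm f)%:C)
  bloch_normC_normD bloch_normC_normZ bloch_normC_eq0.

Lemma bloch_shift_subproof (f : bloch) : (fun z => z * f z) \in bloch_pred.
Proof.
case: (blochP f) => f0 df _; apply/asboolP; split => [z z1|z z1|].
- by rewrite f0// mulr0.
- by apply: derivableM; [exact: derivable_id|exact: df].
exists (normc (f 0) + sup (bloch_values f) + sup (bloch_values f)).
move=> _ [z /= z1 <-]; have := z1; rewrite normc_lt1 => nz1.
have pz : 0 <= 1 - normc z ^+ 2 by rewrite subr_ge0 expr_le1 ?normc_ge0// ltW.
have dfz := df z z1.
have dE : derive1 (fun w => w * f w) z = f 0 + (f z - f 0) + z * derive1 f z.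
  rewrite !derive1E (@deriveM C C id f z 1 (@derivable_id C C z 1) dfz).
  by rewrite derive_id [f z *: _]mulr1 [RHS]addrC [f 0 + _]addrC subrK.
rewrite /bloch_weight dE (le_trans (ler_wpM2l pz (ler_normcD _ _)))//.
rewrite mulrDr lerD//.
  rewrite (le_trans (ler_wpM2l pz (ler_normcD _ _)))// mulrDr lerD//.
    by rewrite ler_piMl ?normc_ge0// gerBl exprn_ge0 ?normc_ge0.
  exact: bloch_growth.
rewrite normcM mulrCA (le_trans _ (bloch_weight_le_sup f z1))//.
by rewrite ler_piMl ?(ltW nz1)//; exact: (bloch_weight_ge0 f z1).
Qed.

Definition bloch_shift (f : bloch) : bloch := Bloch (bloch_shift_subproof f).

Definition closed_invariant_subspace (E : set bloch) : Prop :=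
  [/\ submod_closed (mem E), closed E & bloch_shift @` E `<=` E].

End bloch_space.

Section quotient_dimension.
Variables (K : fieldType) (V : lmodType K).
Implicit Types E F : set V.

(* The classes of the [b i] modulo [F] form a basis of [E / F]. *)
Definition quotient_basis E F n (b : 'I_n -> V) : Prop :=
  [/\ forall i, E (b i),
      forall c : 'I_n -> K, F (\sum_i c i *: b i) -> forall i, c i = 0
    & forall x, E x -> exists c : 'I_n -> K, F (x - \sum_i c i *: b i)].

(* [None] stands for an infinite dimension. *)
Definition quotient_dim E F (N : option nat) : Prop :=
  if N is Some n then exists b : 'I_n -> V, quotient_basis E F b
  else ~ exists n, exists b : 'I_n -> V, quotient_basis E F b.

End quotient_dimension.

Definition has_index (R : realType) (E : set (bloch R)) (N : option nat) : Prop :=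
  quotient_dim E (@bloch_shift R @` E) N.

(* Main.v *)
From HB Require Import structures.
Require Import Defs.
From mathcomp Require Import all_boot all_order all_algebra complex.
From mathcomp Require Import all_classical all_reals all_analysis.
From mathcomp Require Import all_solvable all_field.
From mathcomp Require Import ring lra zify.

(** The construction rests on lacunary series.  Each exponent [2 ^ K] carries
    the label [(logn 2 K).+1], so that every positive label occurs infinitely
    often.  Let [b_0 = 1] and, for [i > 0], let [b_i] be the sum of the
    [z ^ (2 ^ K)] over the [K] of label [i]: this is a Bloch function.  Consider
    the Bloch functions whose Taylor coefficients, on the block of exponents
    starting at a large [2 ^ K], are those of a polynomial [P_i] depending only
    on the label [i] of [K]; let [E] be their closure, keeping only the labels
    below [N].  The number [P_i(0)] is a Taylor coefficient at arbitrarily large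
    [2 ^ K], and the Taylor coefficients of a Bloch function are bounded by a
    multiple of its norm (average the derivative over roots of unity).  So
    [g |-> P_i(0)] is bounded; it vanishes on [zE] and takes the value 1 at
    [b_i] and 0 at the other [b_j], hence the [b_i] are independent modulo [zE].
    If all the [P_i(0)] vanish then [g] is divisible by [z] within the span, and
    division by [z] is bounded; so the [b_i] with [i < N] span [E / zE] when [N]
    is finite. *)

Set Implicit Arguments.
Unset Strict Implicit.
Unset Printing Implicit Defensive.

Import Order.TTheory GRing.Theory Num.Theory numFieldNormedType.Exports.
Import ComplexField.Normc.

Local Open Scope classical_set_scope.
Local Open Scope ring_scope.
Local Open Scope complex_scope.

(** * Complex numbers and finite sums *)

Section numeric.
Variable R : realType.
Local Notation C := R[i].
Implicit Types (z w : C) (q r s : R).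

Lemma normcX z n : normc (z ^+ n) = normc z ^+ n.
Proof.
by elim: n => [|n IH]; rewrite ?expr0 ?normc1// !exprS normcM IH.
Qed.

Lemma ler_normc_sum (I : Type) (s : seq I) (P : pred I) (F : I -> C) :
  normc (\sum_(i <- s | P i) F i) <= \sum_(i <- s | P i) normc (F i).
Proof.
elim/big_ind2: _ => [|a b c d ab cd|//]; first by rewrite normc0.
exact: le_trans (ler_normcD _ _) (lerD ab cd).
Qed.

Lemma normc_nat n : normc (n%:R : C) = n%:R.
Proof. by rewrite -(rmorph_nat (real_complex R)) normc_real ger0_norm. Qed.

Lemma distcC z w : normc (z - w) = normc (w - z).
Proof. by rewrite -normcN opprB. Qed.

Lemma ler_distcD z w u : normc (z - u) <= normc (z - w) + normc (w - u).
Proof. by rewrite -[X in normc X](subrKA w) ler_normcD. Qed.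

Lemma ler_normc_distl z w : normc z <= normc w + normc (z - w).
Proof. by rewrite -{1}[z](subrKC w) ler_normcD. Qed.

Lemma normc_gt0 z : z != 0 -> 0 < normc z.
Proof.
by move=> z0; rewrite lt_def normc_ge0 andbT; apply: contra z0 => /eqP/eq0_normc ->.
Qed.

Lemma normc_le_ReIm z : normc z <= `|complex.Re z| + `|complex.Im z|.
Proof.
case: z => a b /=; rewrite -[leRHS]ger0_norm ?addr_ge0// -sqrtr_sqr.
rewrite ler_wsqrtr// sqrrD !real_normK ?num_real// -addrA lerD2l.
by rewrite lerDr mulrn_wge0// mulr_ge0.
Qed.

Lemma Im_le_normc z : complex.Im z <= normc z.
Proof.
case: z => a b /=; rewrite (le_trans (ler_norm _))// -sqrtr_sqr.
by rewrite ler_wsqrtr// lerDr sqr_ge0.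
Qed.

(* The supremum of the lower bounds [u i - e i] works. *)
Lemma real_center (I : Type) (i0 : I) (u e : I -> R) :
  (forall i j, u i - u j <= e i + e j) -> exists l, forall i, `|u i - l| <= e i.
Proof.
move=> ue; pose S := range (fun i => u i - e i).
have S0 : S !=set0 by exists (u i0 - e i0), i0.
exists (sup S) => i; rewrite distrC ler_distl; apply/andP; split.
  apply: ub_le_sup; last by exists i.
  by exists (u i0 + e i0) => _ [j _ <-]; have := ue j i0; lra.
by apply: ge_sup => // _ [j _ <-]; have := ue j i; lra.
Qed.

(** Real and imaginary parts are centred separately, which costs the factor 2. This stands in for
    completeness: it yields limits of partial sums and extends bounded functionals to limit
    points. *)
Lemma complex_center (I : Type) (i0 : I) (u : I -> C) (e : I -> R) :
  (forall i j, normc (u i - u j) <= e i + e j) ->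
  exists l, forall i, normc (u i - l) <= 2 * e i.
Proof.
move=> ue.
have [a ae] : exists l, forall i, `|complex.Re (u i) - l| <= e i.
  apply: (real_center i0) => i j.
  by apply: le_trans (ue i j); rewrite -raddfB; exact: Re_le_normc.
have [b be] : exists l, forall i, `|complex.Im (u i) - l| <= e i.
  apply: (real_center i0) => i j.
  by apply: le_trans (ue i j); rewrite -raddfB; exact: Im_le_normc.
exists (a +i* b) => i; apply: le_trans (normc_le_ReIm _) _.
rewrite mulr_natl mulr2n !raddfB/=; exact: lerD.
Qed.

Lemma expr_small q c e : 0 <= q < 1 -> 0 < e ->
  exists L0, forall L, (L0 <= L)%N -> c * q ^+ L <= e.
Proof.
move=> /andP[q0 q1] e0.
have /cvgr0Pnorm_lt/(_ _ e0)[L0 _ H] : (geometric c q) x @[x --> \oo] --> 0.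
  by apply: cvg_geometric; rewrite ger0_norm.
by exists L0 => L /H /= /ltW; apply: le_trans; exact: ler_norm.
Qed.

Lemma geometric_sum_le q m n : 0 <= q < 1 ->
  \sum_(m <= i < n) q ^+ i <= q ^+ m / (1 - q).
Proof.
move=> /andP[q0 q1]; have q1' : 0 < 1 - q by rewrite subr_gt0.
rewrite ler_pdivlMr//; have [mn|nm] := leqP m n; last first.
  by rewrite big_geq ?mul0r ?exprn_ge0// ltnW.
suff -> : (\sum_(m <= i < n) q ^+ i) * (1 - q) = q ^+ m - q ^+ n.
  by rewrite gerBl exprn_ge0.
elim: n mn => [|n IH]; first by rewrite leqn0 => /eqP ->; rewrite big_geq// mul0r subrr.
rewrite leq_eqVlt => /predU1P[->|mn]; first by rewrite big_geq// mul0r subrr.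
by rewrite big_nat_recr//= mulrDl IH// exprS; ring.
Qed.

Lemma geometric_sum_mul_le q n : 0 <= q < 1 ->
  (1 - q) * (\sum_(i < n) (i.+1)%:R * q ^+ i) <= (1 - q)^-1.
Proof.
move=> q01; have [q0 q1] := andP q01.
rewrite (_ : _ * _ = \sum_(i < n) q ^+ i - n%:R * q ^+ n).
  rewrite lerBlDr -[leLHS]addr0 lerD ?mulr_ge0 ?exprn_ge0//.
  by rewrite -(big_mkord xpredT (fun i => q ^+ i)) -[leRHS]mul1r -(expr0 q) geometric_sum_le.
elim: n => [|n IH]; first by rewrite !big_ord0 mulr0 mul0r subr0.
by rewrite !big_ord_recr/= mulrDr IH !exprS -natr1; ring.
Qed.

Lemma weighted_sum1_le q n : 0 <= q < 1 ->
  \sum_(i < n) (i.+1)%:R * q ^+ i <= (1 - q)^-1 ^+ 2.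
Proof.
move=> q01; have [q0 q1] := andP q01; have q1' : 0 < 1 - q by rewrite subr_gt0.
by rewrite expr2 ler_pdivlMl// geometric_sum_mul_le.
Qed.

Lemma weighted_sum2_le q n : 0 <= q < 1 ->
  \sum_(i < n) 'C(i.+2, 2)%:R * q ^+ i <= (1 - q)^-1 ^+ 3.
Proof.
move=> q01; have [q0 q1] := andP q01; have q1' : 0 < 1 - q by rewrite subr_gt0.
rewrite exprS ler_pdivlMl//; apply: le_trans (weighted_sum1_le n q01).
rewrite (_ : _ * _ = \sum_(i < n) (i.+1)%:R * q ^+ i - 'C(n.+1, 2)%:R * q ^+ n).
  by rewrite gerBl mulr_ge0 ?exprn_ge0.
elim: n => [|n IH]; first by rewrite !big_ord0 mulr0 mul0r subr0.
by rewrite !big_ord_recr/= mulrDr IH exprS (binS n.+1 1) bin1 natrD; ring.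
Qed.

Lemma natr_mulX_le q n : 0 <= q < 1 -> (n.+1)%:R * q ^+ n <= (1 - q)^-1.
Proof.
move=> q01; have [q0 q1] := andP q01.
apply: (@le_trans _ _ (\sum_(0 <= i < n.+1) q ^+ i)).
  rewrite big_mkord -[X in X%:R * _]card_ord -sum1_card natr_sum mulr_suml.
  apply: ler_sum => i _; rewrite mul1r ler_wiXn2l// ?ltW//.
  by rewrite -ltnS ltn_ord.
by rewrite -[leRHS]mul1r -(expr0 q) geometric_sum_le.
Qed.

(** * Roots of unity and extraction of coefficients *)

Lemma exists_prim_root n : (0 < n)%N -> exists z : C, n.-primitive_root z.
Proof.
move=> n0; pose p : {poly C} := 'X^n - 1.
have [rs Dp] := closed_field_poly_normal p.
rewrite (monicP _) ?monicXnsubC// scale1r in Dp.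
have rn1 : all n.-unity_root rs.
  by apply/allP => z; rewrite -root_prod_XsubC -Dp.
have sz : (n < (size rs).+1)%N.
  by rewrite -(size_prod_XsubC rs id) -Dp size_XnsubC.
have [|z] := hasP (has_prim_root n0 rn1 _ sz); last by exists z.
by rewrite -separable_prod_XsubC -Dp separable_Xn_sub_1// pnatr_eq0 -lt0n.
Qed.

(* Averaging over the [L]-th roots of unity isolates the coefficient [b n]. *)
Lemma coef_le_circle (b : nat -> C) n L r M : (n < L)%N -> 0 <= r ->
  (forall z, normc z = r -> normc (\sum_(m < L) b m * z ^+ m) <= M) ->
  normc (b n) * r ^+ n <= M.
Proof.
move=> nL r0 bM; have L0 : (0 < L)%N by exact: leq_ltn_trans nL.
have [x px] := exists_prim_root L0.
have nx : normc x = 1.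
  apply/eqP; rewrite -(@pexpr_eq1 _ _ L)// ?normc_ge0//.
  by rewrite -normcX (prim_expr_order px) normc1.
(* The factor [x ^+ (t * (L - n))] is $x^{-tn}$ written with a natural exponent. *)
pose S := \sum_(t < L) (\sum_(m < L) b m * (r%:C * x ^+ t) ^+ m) * x ^+ (t * (L - n)).
have SE : S = L%:R * (b n * r%:C ^+ n).
  rewrite /S; under eq_bigr do rewrite mulr_suml.
  rewrite exchange_big/= (bigD1 (Ordinal nL))//= [X in _ + X]big1 ?addr0.
    rewrite -[X in X%:R * _]card_ord -sum1_card natr_sum mulr_suml.
    apply: eq_bigr => t _; rewrite mul1r exprMn -exprM -!mulrA -exprD -mulnDr.
    by rewrite subnKC ?(ltnW nL)// mulnC exprM (prim_expr_order px) expr1n mulr1.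
  move=> m mn; have mE t : b m * (r%:C * x ^+ t) ^+ m * x ^+ (t * (L - n)) =
      b m * r%:C ^+ m * (x ^+ (m + (L - n))) ^+ t.
    by rewrite exprMn -!mulrA -!exprM -exprD -mulnDr mulnC.
  under eq_bigr do rewrite mE.
  rewrite -mulr_sumr; set y := x ^+ _.
  (* Since $0 < m + L - n < 2L$, the power [y] of [x] equals 1 only when this exponent is $L$, that
     is, when $m = n$. *)
  have y1 : y != 1.
    rewrite /y -(prim_order_dvd px); apply: contra mn => /dvdnP[k kE].
    have mL := ltn_ord m; have k1 : k = 1%N.
      have : (0 < k * L)%N by rewrite -kE addn_gt0 subn_gt0 nL orbT.
      have : (k * L < 2 * L)%N by rewrite -kE mul2n -addnn -addSn leq_add// leq_subr.
      by rewrite ltn_pmul2r// muln_gt0 L0 andbT; case: k {kE} => [|[|]].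
    apply/eqP/val_inj => /=; move: kE; rewrite k1 mul1n => mE'.
    by have := ltnW nL; lia.
  have : (y - 1) * (\sum_(t < L) y ^+ t) = 0.
    by rewrite -subrX1 /y exprAC (prim_expr_order px) expr1n subrr.
  by move/eqP; rewrite mulf_eq0 subr_eq0 (negPf y1)/= => /eqP ->; rewrite mulr0.
have SM : normc S <= L%:R * M.
  apply: le_trans (ler_normc_sum _ _ _) _.
  rewrite -[X in X%:R * _]card_ord -sum1_card natr_sum mulr_suml.
  apply: ler_sum => t _; rewrite mul1r normcM [normc (x ^+ _)]normcX nx expr1n mulr1.
  by apply: bM; rewrite normcM normcX nx expr1n mulr1 normc_real ger0_norm.
move: SM; rewrite SE normcM normcM normcX normc_real ger0_norm//.
by rewrite normc_nat ler_pM2l ?ltr0n.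
Qed.

End numeric.

(** * Power series with bounded coefficients *)

Section power_series.
Variable R : realType.
Local Notation C := R[i].
Implicit Types (f g : C -> C) (c b : nat -> C) (z w h : C) (B q s r : R).

Definition psum c L z : C := \sum_(m < L) c m * z ^+ m.

Lemma psum_tail c z B q L L' : 0 <= q < 1 ->
  (forall m, normc (c m * z ^+ m) <= B * q ^+ m) -> (L <= L')%N ->
  normc (psum c L' z - psum c L z) <= B / (1 - q) * q ^+ L.
Proof.
move=> q01 cB LL'.
have B0 : 0 <= B by have := cB 0%N; rewrite !expr0 !mulr1; apply: le_trans; exact: normc_ge0.
rewrite /psum -!(big_mkord xpredT (fun m => c m * z ^+ m)) (big_cat_nat _ LL')//=.
rewrite addrAC subrr add0r.
apply: le_trans (ler_normc_sum _ _ _) _.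
apply: (@le_trans _ _ (\sum_(L <= m < L') B * q ^+ m)); first exact: ler_sum.
by rewrite -mulr_sumr -mulrA [_^-1 * _]mulrC ler_wpM2l// geometric_sum_le.
Qed.

(** A geometric error with any constant [D] forces convergence; comparison with a distant partial
    sum then replaces [D] by the tail constant. *)
Lemma psum_improve c z B q l D : 0 <= q < 1 ->
  (forall m, normc (c m * z ^+ m) <= B * q ^+ m) ->
  (forall L, normc (l - psum c L z) <= D * q ^+ L) ->
  forall L, normc (l - psum c L z) <= B / (1 - q) * q ^+ L.
Proof.
move=> q01 cB lD L; apply/ler_addgt0Pl => e e0.
have [L0 HL0] := expr_small D q01 e0.
apply: le_trans (ler_distcD _ (psum c (maxn L0 L) z) _) _.
rewrite lerD//; first by apply: le_trans (lD _) (HL0 _ (leq_maxl _ _)).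
exact: psum_tail (leq_maxr _ _).
Qed.

Lemma psum_limit c z B q : 0 <= q < 1 ->
  (forall m, normc (c m * z ^+ m) <= B * q ^+ m) ->
  exists l, forall L, normc (l - psum c L z) <= B / (1 - q) * q ^+ L.
Proof.
move=> q01 cB; have [q0 q1] := andP q01.
have B0 : 0 <= B by have := cB 0%N; rewrite !expr0 !mulr1; apply: le_trans; exact: normc_ge0.
pose e L := B / (1 - q) * q ^+ L.
have e0 L : 0 <= e L by rewrite mulr_ge0 ?exprn_ge0// divr_ge0// subr_ge0 ltW.
have [|l lE] := @complex_center R nat 0%N (fun L => psum c L z) e.
  move=> L L'; have [LL'|/ltnW LL'] := leqP L L'.
    by rewrite distcC (le_trans (psum_tail q01 cB LL'))// lerDl e0.
  by rewrite (le_trans (psum_tail q01 cB LL'))// lerDr e0.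
exists l; apply: (@psum_improve _ _ _ _ _ (2 * (B / (1 - q)))) => // L.
by rewrite distcC (le_trans (lE L))// /e mulrA.
Qed.

(** Convergence is encoded by an explicit rate: when the coefficients are bounded by [B], the tail
    from [L] on is at most $B|z|^L/(1-|z|)$. *)
Definition power_series f c B :=
  (forall m, normc (c m) <= B) /\
  forall z L, normc z < 1 ->
    normc (f z - psum c L z) <= B / (1 - normc z) * normc z ^+ L.

Lemma normc_coefX c z B m : (forall m, normc (c m) <= B) ->
  normc (c m * z ^+ m) <= B * normc z ^+ m.
Proof. by move=> cB; rewrite normcM normcX ler_wpM2r ?exprn_ge0 ?normc_ge0. Qed.

Lemma power_series_exists c B : (forall m, normc (c m) <= B) ->
  exists f, (forall z, 1 <= normc z -> f z = 0) /\ power_series f c B.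
Proof.
move=> cB.
have H z : exists l, (1 <= normc z -> l = 0) /\ (normc z < 1 ->
    forall L, normc (l - psum c L z) <= B / (1 - normc z) * normc z ^+ L).
  have [z1|z1] := leP 1 (normc z); first by exists 0.
  have [||l lP] := @psum_limit c z B (normc z); first by rewrite normc_ge0.
    by move=> m; exact: normc_coefX.
  by exists l.
have [f fP] := choice H.
by exists f; split=> [z /(fP z).1//|]; split=> // z L /(fP z).2.
Qed.

Lemma power_series_bound f c B B' : power_series f c B ->
  (forall m, normc (c m) <= B') -> power_series f c B'.
Proof.
move=> [cB fB] cB'; split=> // z L z1.
apply: (@psum_improve _ _ _ _ _ (B / (1 - normc z))) L; first by rewrite normc_ge0.
  by move=> m; exact: normc_coefX.
by move=> L; exact: fB.
Qed.

Lemma power_series_ext f g c B : (forall z, normc z < 1 -> f z = g z) ->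
  power_series f c B -> power_series g c B.
Proof. by move=> fg [cB fB]; split=> // z L z1; rewrite -fg// fB. Qed.

Lemma power_series_eq f g c B B' : power_series f c B -> power_series g c B' ->
  forall z, normc z < 1 -> f z = g z.
Proof.
move=> [_ fB] [_ gB] z z1; apply/eqP; rewrite -subr_eq0; apply/eqP/eq0_normc.
apply/eqP; rewrite eq_le normc_ge0 andbT; apply/ler_addgt0Pl => e e0.
have z01 : 0 <= normc z < 1 by rewrite normc_ge0.
have [L HL] := expr_small ((B + B') / (1 - normc z)) z01 e0.
rewrite addr0 (le_trans _ (HL L (leqnn _)))// (le_trans (ler_distcD _ (psum c L z) _))//.
rewrite [normc (psum _ _ _ - _)]distcC (le_trans (lerD (fB z L z1) (gB z L z1)))//.
by rewrite -mulrDl -mulrDl.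
Qed.

Lemma power_series_at0 f c B : power_series f c B -> f 0 = c 0%N.
Proof.
(* At $z = 0$ with [L] equal to 1 the error bound is 0, so equality is exact. *)
move=> [_ /(_ 0 1%N)]; rewrite normc0 => /(_ ltr01).
rewrite expr1 mulr0 /psum big_ord1 expr0 mulr1 => H.
apply/eqP; rewrite -subr_eq0; apply/eqP/eq0_normc/eqP.
by rewrite eq_le H normc_ge0.
Qed.

Lemma power_seriesD a f g c b B B' : power_series f c B -> power_series g b B' ->
  power_series (fun z => a * f z + g z) (fun m => a * c m + b m)
    (normc a * B + B').
Proof.
move=> [cB fB] [bB gB]; split=> [m|z L z1].
  rewrite (le_trans (ler_normcD _ _))// lerD// normcM ler_wpM2l ?normc_ge0//.
have -> : psum (fun m => a * c m + b m) L z = a * psum c L z + psum b L z.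
  rewrite /psum mulr_sumr -big_split/=; apply: eq_bigr => i _.
  by rewrite mulrDl mulrA.
rewrite opprD addrACA -mulrBr (le_trans (ler_normcD _ _))// mulrDl mulrDl lerD ?gB//.
by rewrite normcM -!mulrA ler_wpM2l ?normc_ge0// mulrA fB.
Qed.

Lemma power_series_shift f c B : power_series f c B ->
  power_series (fun z => z * f z) (fun m => if m is m'.+1 then c m' else 0) B.
Proof.
move=> [cB fB].
have B0 : 0 <= B by apply: le_trans (cB 0%N); exact: normc_ge0.
split=> [[|m]|z [|L] z1]; rewrite ?normc0//.
  rewrite /psum big_ord0 subr0 normcM; have := fB z 0%N z1.
  rewrite /psum big_ord0 subr0 => H.
  by rewrite (le_trans _ H)// ler_piMl ?normc_ge0// ltW.
have -> : psum (fun m => if m is m'.+1 then c m' else 0) L.+1 z = z * psum c L z.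
  rewrite /psum big_ord_recl mul0r add0r mulr_sumr; apply: eq_bigr => i _.
  by rewrite exprS mulrCA.
rewrite -mulrBr normcM exprS mulrCA ler_wpM2l ?normc_ge0//.
exact: fB.
Qed.

(** * Termwise differentiation *)

Definition dcoef c m : C := m.+1%:R * c m.+1.

(** Induction: the remainder of degree $n+3$ is $z+h$ times that of degree $n+2$ plus
    $(n+2)h^2z^{n+1}$, and Pascal's rule adds up the binomial coefficients. *)
Lemma taylor2_bound z h r n : normc z <= r -> normc (z + h) <= r ->
  normc ((z + h) ^+ n.+2 - z ^+ n.+2 - n.+2%:R * h * z ^+ n.+1) <=
  normc h ^+ 2 * ('C(n.+2, 2)%:R * r ^+ n).
Proof.
move=> zr wr; have r0 : 0 <= r by exact: le_trans (normc_ge0 _) zr.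
elim: n => [|n IH].
  rewrite (_ : _ - _ = h ^+ 2); last by ring.
  by rewrite normcX binn mulr1n expr0 !mulr1.
set D := (X in normc X) in IH.
rewrite (_ : _ - _ = (z + h) * D + n.+2%:R * (h ^+ 2 * z ^+ n.+1)); last first.
  by rewrite /D !exprS; ring.
rewrite (le_trans (ler_normcD _ _))// (binS n.+2 1) bin1 natrD.
rewrite [X in _ <= _ * X]mulrDl [leRHS]mulrDr lerD//.
  rewrite normcM [r ^+ n.+1]exprS (mulrCA _ r) (mulrCA _ r).
  by rewrite ler_pM ?normc_ge0.
rewrite normcM normc_nat normcM !normcX mulrCA ler_wpM2l ?sqr_ge0//.
by rewrite ler_wpM2l// lerXn2r ?nnegrE ?normc_ge0.
Qed.

(** The bound does not depend on [L], so the quadratic estimate survives the passage to the sum of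
    the series. *)
Lemma psum_taylor c z h B r L : (forall m, normc (c m) <= B) -> r < 1 ->
  normc z <= r -> normc (z + h) <= r ->
  normc (psum c L.+2 (z + h) - psum c L.+2 z - h * psum (dcoef c) L.+1 z) <=
  B * (1 - r)^-1 ^+ 3 * normc h ^+ 2.
Proof.
move=> cB r1 zr wr; have r0 : 0 <= r by exact: le_trans (normc_ge0 _) zr.
have B0 : 0 <= B by apply: le_trans (cB 0%N); exact: normc_ge0.
have -> : psum c L.+2 (z + h) - psum c L.+2 z - h * psum (dcoef c) L.+1 z =
    \sum_(m < L) c m.+2 * ((z + h) ^+ m.+2 - z ^+ m.+2 - m.+2%:R * h * z ^+ m.+1).
  rewrite /psum /dcoef; elim: L => [|L IH].
    by rewrite !big_ord_recl !big_ord0 !expr0 /= /bump/=; ring.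
  rewrite big_ord_recr [in RHS]big_ord_recr/= -IH.
  rewrite [X in _ - X - _]big_ord_recr [X in _ - h * X]big_ord_recr/=.
  by ring.
rewrite (le_trans (ler_normc_sum _ _ _))//.
apply: (@le_trans _ _ (\sum_(m < L) B * normc h ^+ 2 * ('C(m.+2, 2)%:R * r ^+ m))).
  apply: ler_sum => m _; rewrite normcM -[leRHS]mulrA ler_pM ?normc_ge0//.
  exact: taylor2_bound.
rewrite -mulr_sumr [leRHS]mulrAC ler_wpM2l ?mulr_ge0 ?exprn_ge0 ?normc_ge0//.
by apply: weighted_sum2_le; rewrite r0.
Qed.

Lemma is_derive_quadratic f z d K e : 0 < e ->
  (forall h, normc h < e -> normc (f (z + h) - f z - h * d) <= K * normc h ^+ 2) ->
  is_derive z (1 : C) f d.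
Proof.
move=> e0 fK.
have H : h^-1 *: (f (h *: 1 + z) - f z) @[h --> (0 : C)^'] --> d.
  apply/(@cvgrPdist_lt C C C (dnbhs 0) _) => eta eta0.
  have eE : eta = (complex.Re eta)%:C.
    by move: eta0; rewrite ltcE/= => /andP[/eqP ie _]; case: eta ie => a b /= ->.
  have : 0 < complex.Re eta by move: eta0; rewrite ltcE/= => /andP[].
  move: (complex.Re eta) eE => x -> x0.
  have K0 : 0 < `|K| + 1 by rewrite ltr_wpDl.
  apply/nbhs_ballP; exists (Num.min e (x / (`|K| + 1)))%:C => /=.
    by rewrite -[0]/(0%:C) ltcR lt_min e0 divr_gt0.
  move=> h; rewrite /ball/= sub0r normrN normC_normc ltcR lt_min => /andP[he hx] h0.
  rewrite normC_normc ltcR.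
  have nh : 0 < normc h by exact: normc_gt0.
  rewrite (_ : _ - _ = - (h^-1 * (f (z + h) - f z - h * d))); last first.
    rewrite [h *: 1]mulr1 [_ *: _]/(h^-1 * _) [h + z]addrC mulrBr mulKf//.
    by rewrite opprB.
  rewrite normcN normcM normcV ltr_pdivrMl// (le_lt_trans (fK h he))//.
  rewrite (_ : K * _ = normc h * (K * normc h)); last by ring.
  rewrite ltr_pM2l// (le_lt_trans (ler_wpM2r (ltW nh) (ler_norm K)))//.
  by move: hx; rewrite ltr_pdivlMr// mulrDr mulr1 mulrC; apply: lt_trans; rewrite ltrDl.
by split; [apply/cvg_ex; exists d; exact: H|exact: (cvg_lim _ H)].
Qed.

(** In $|z|^m \le s^m s^m$ one factor absorbs $m+1$, so the derived series still converges
    geometrically. Its sum is the derivative by the uniform estimate of [psum_taylor]. *)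
Lemma power_series_is_derive f c B z s : power_series f c B -> 0 <= s < 1 ->
  normc z <= s ^+ 2 -> exists d, is_derive z (1 : C) f d /\
    forall L, normc (d - psum (dcoef c) L z) <= B / (1 - s) / (1 - s) * s ^+ L.
Proof.
move=> [cB fB] s01 zs; have [s0 s1] := andP s01.
have B0 : 0 <= B by apply: le_trans (cB 0%N); exact: normc_ge0.
have z1 : normc z < 1 by rewrite (le_lt_trans zs)// expr_lt1.
have [|d dP] := @psum_limit (dcoef c) z (B / (1 - s)) s s01.
  move=> m; rewrite normcM normcM normc_nat normcX.
  apply: (@le_trans _ _ (m.+1%:R * B * (s ^+ 2) ^+ m)).
    rewrite ler_pM ?mulr_ge0 ?exprn_ge0 ?normc_ge0//; first by rewrite ler_wpM2l.
    by rewrite lerXn2r ?nnegrE ?normc_ge0 ?exprn_ge0.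
  rewrite -exprM mul2n -addnn exprD mulrA ler_wpM2r ?exprn_ge0//.
  by rewrite mulrAC [leLHS]mulrC ler_wpM2l// natr_mulX_le.
(* The midpoint [r] between $|z|$ and 1 bounds both $|z|$ and $|z+h|$ whenever $|h| < r-|z|$. *)
exists d; split=> //; pose r := (1 + normc z) / 2.
have r1 : r < 1 by rewrite /r; lra.
have zr : normc z < r by rewrite /r; lra.
have rz0 : 0 < r - normc z by rewrite subr_gt0.
have r0 : 0 <= r by rewrite ltW// (le_lt_trans (normc_ge0 z)).
apply: (@is_derive_quadratic f z d (B * (1 - r)^-1 ^+ 3) _ rz0) => h hr.
have wr : normc (z + h) <= r.
  by rewrite (le_trans (ler_normcD _ _))// -lerBrDl ltW.
have w1 := le_lt_trans wr r1.
apply/ler_addgt0Pl => e e0.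
have e3 : 0 < e / 3 by rewrite divr_gt0.
have eh : 0 < e / 3 / (normc h + 1) by rewrite divr_gt0// ltr_wpDl// normc_ge0.
have z01 : 0 <= normc z < 1 by rewrite normc_ge0.
have w01 : 0 <= normc (z + h) < 1 by rewrite normc_ge0.
have [L1 H1] := expr_small (B / (1 - normc z)) z01 e3.
have [L2 H2] := expr_small (B / (1 - normc (z + h))) w01 e3.
have [L3 H3] := expr_small (B / (1 - s) / (1 - s)) s01 eh.
pose L := (L1 + L2 + L3)%N.
have [L1L L2L L3L] : [/\ (L1 <= L.+2)%N, (L2 <= L.+2)%N & (L3 <= L.+1)%N].
  by split; rewrite !leqW// /L ?leq_addl// -?addnA ?leq_addr// addnCA leq_addr.
have E1 : normc (f z - psum c L.+2 z) <= e / 3.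
  exact: le_trans (fB _ _ z1) (H1 _ L1L).
have E2 : normc (f (z + h) - psum c L.+2 (z + h)) <= e / 3.
  exact: le_trans (fB _ _ w1) (H2 _ L2L).
have E3 : normc (h * (d - psum (dcoef c) L.+1 z)) <= e / 3.
  have := le_trans (dP _) (H3 _ L3L).
  rewrite ler_pdivlMr ?ltr_wpDl ?normc_ge0//; apply: le_trans.
  by rewrite normcM mulrC ler_wpM2l ?normc_ge0// lerDl.
have := psum_taylor L cB r1 (ltW zr) wr.
set T := psum c L.+2 (z + h) - psum c L.+2 z - h * psum (dcoef c) L.+1 z => ET.
rewrite (_ : f (z + h) - f z - h * d = (f (z + h) - psum c L.+2 (z + h))
  - (f z - psum c L.+2 z) - h * (d - psum (dcoef c) L.+1 z) + T); last by rewrite /T; ring.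
rewrite (le_trans (ler_normcD _ _))// lerD// (le_trans (ler_normcD _ _))// normcN.
rewrite (le_trans (lerD (ler_normcD _ _) (lexx _)))// normcN.
by move: E1 E2 E3; lra.
Qed.

End power_series.

(** * Taylor coefficients of Bloch functions *)

Section bloch_power_series.
Variable R : realType.
Local Notation C := R[i].
Local Notation bloch := (bloch R).
Implicit Types (f g : C -> C) (c b : nat -> C) (z w h : C) (B q s r M : R).

Lemma power_series_derive1 f c B z : power_series f c B -> normc z < 1 ->
  let s := Num.sqrt (normc z) in
  derivable f z 1 /\ forall L,
    normc (derive1 f z - psum (dcoef c) L z) <= B / (1 - s) / (1 - s) * s ^+ L.
Proof.
move=> fc z1 s.
have s01 : 0 <= s < 1 by rewrite sqrtr_ge0 -sqrtr1 ltr_sqrt.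
have zs : normc z <= s ^+ 2 by rewrite sqr_sqrtr// normc_ge0.
have [d [[fd fE] dL]] := power_series_is_derive fc s01 zs.
by split=> // L; rewrite derive1E fE.
Qed.

Lemma sqrt_normc_lt1 z : normc z < 1 -> 0 <= Num.sqrt (normc z) < 1.
Proof. by move=> z1; rewrite sqrtr_ge0 -sqrtr1 ltr_sqrt. Qed.

Lemma one_minus_sq_ge0 z : normc z < 1 -> 0 <= 1 - normc z ^+ 2.
Proof. by move=> z1; rewrite subr_ge0 expr_le1 ?normc_ge0// ltW. Qed.

(** A cofinal set of lengths is enough: lacunary sums are estimated only at the lengths $2^K$. *)
Lemma derive1_le_psum f c B z M : power_series f c B -> normc z < 1 ->
  (forall L0, exists2 L, (L0 <= L)%N & normc (psum (dcoef c) L z) <= M) ->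
  normc (derive1 f z) <= M.
Proof.
move=> fc z1 cM; have [_ fL] := power_series_derive1 fc z1.
apply/ler_addgt0Pr => e e0.
have [L0 HL0] := expr_small (B / (1 - Num.sqrt (normc z)) / (1 - Num.sqrt (normc z)))
  (sqrt_normc_lt1 z1) e0.
have [L L0L ML] := cM L0.
rewrite (le_trans (ler_normc_distl _ (psum (dcoef c) L z)))// lerD//.
exact: le_trans (fL L) (HL0 L L0L).
Qed.

Lemma bernoulli_inequality (x : R) n : 0 <= x <= 1 -> 1 - n%:R * x <= (1 - x) ^+ n.
Proof.
move=> /andP[x0 x1]; elim: n => [|n IH]; first by rewrite mul0r subr0 expr0.
rewrite exprS (@le_trans _ _ ((1 - x) * (1 - n%:R * x)))//; last first.
  by rewrite ler_wpM2l// subr_ge0.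
rewrite -natr1 -subr_ge0 (_ : _ - _ = n%:R * x ^+ 2); last by ring.
by rewrite mulr_ge0// sqr_ge0.
Qed.

Lemma bloch_sup_le_norm (f : bloch) : sup (bloch_values f) <= bloch_norm f.
Proof. by rewrite lerDr normc_ge0. Qed.

Lemma bloch_at0_le_norm (f : bloch) : normc (f 0) <= bloch_norm f.
Proof. by rewrite lerDl bloch_sup_ge0. Qed.

Lemma bloch_norm_ge0 (f : bloch) : 0 <= bloch_norm f.
Proof. exact: le_trans (normc_ge0 _) (bloch_at0_le_norm f). Qed.

Lemma bloch_weight_le_norm (f : bloch) z : normc z < 1 ->
  bloch_weight f z <= bloch_norm f.
Proof.
rewrite -normc_lt1 => z1.
exact: le_trans (bloch_weight_le_sup f z1) (bloch_sup_le_norm f).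
Qed.

(* For the coefficient [c n.+1], average [derive1 f] over the circle of radius
   [1 - 1 / (2 (n + 1))]. *)
Lemma bloch_coef_le (f : bloch) c B : power_series f c B ->
  forall m, normc (c m) <= 4 * bloch_norm f.
Proof.
move=> fc [|n].
  rewrite -(power_series_at0 fc) (le_trans (bloch_at0_le_norm f))//.
  by rewrite ler_peMl ?bloch_norm_ge0// ler1n.
pose x : R := (n.+1%:R * 2)^-1.
have nx : n.+1%:R * x = 2^-1 by rewrite /x invfM mulrA divff ?mul1r// pnatr_eq0.
have x0 : 0 < x by rewrite invr_gt0 mulr_gt0.
have x1 : x <= 2^-1 by rewrite /x invfM ler_piMl ?invr_ge0// invf_le1 ?ler1n.
pose r : R := 1 - x.
have r0 : 0 <= r by rewrite /r; lra.
have r1 : r < 1 by rewrite /r; lra.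
have rn : 2^-1 <= r ^+ n.
  apply: le_trans (bernoulli_inequality n _); last by apply/andP; split; lra.
  by move: nx; rewrite -natr1 mulrDl mul1r; lra.
have rr : 0 < 1 - r ^+ 2 by rewrite subr_gt0 expr_lt1.
have s01 : 0 <= Num.sqrt r < 1 by rewrite sqrtr_ge0 -sqrtr1 ltr_sqrt.
have H : normc (dcoef c n) * r ^+ n <= bloch_norm f / (1 - r ^+ 2).
  apply/ler_addgt0Pr => e e0.
  have [L0 HL0] := expr_small (B / (1 - Num.sqrt r) / (1 - Num.sqrt r)) s01 e0.
  pose L := maxn n.+1 L0.
  apply: (@coef_le_circle _ _ _ L) => // [|z zr]; first exact: leq_maxl.
  have z1 : normc z < 1 by rewrite zr.
  have [_ /(_ L)] := power_series_derive1 fc z1.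
  rewrite distcC zr => fL.
  rewrite (le_trans (ler_normc_distl _ (derive1 f z)))// lerD//.
    rewrite ler_pdivlMr// -zr mulrC; exact: bloch_weight_le_norm.
  by apply: le_trans fL (HL0 _ _); rewrite /L leq_maxr.
move: H; rewrite /dcoef normcM normc_nat ler_pdivlMr// => H.
have := normc_ge0 (c n.+1); set y := normc _ in H * => y0.
(* The left factor of $(n+1)x \cdot r^n(1+r)$ is $1/2$, and $r^n \ge 1/2$; hence the constant 4. *)
have E : 4^-1 <= n.+1%:R * r ^+ n * (1 - r ^+ 2).
  have -> : n.+1%:R * r ^+ n * (1 - r ^+ 2) = n.+1%:R * x * (r ^+ n * (1 + r)).
    by rewrite /r; ring.
  rewrite nx (_ : 4^-1 = 2^-1 * 2^-1 :> R); last by field.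
  rewrite ler_wpM2l ?invr_ge0// (le_trans rn)// ler_peMr ?exprn_ge0//.
  by rewrite lerDl.
rewrite -ler_pdivrMl// (le_trans _ H)//.
rewrite (_ : _ * (1 - _) = n.+1%:R * r ^+ n * (1 - r ^+ 2) * y); last by ring.
by rewrite ler_wpM2r.
Qed.

Lemma bloch_of_power_series f c B M : (forall z, 1 <= normc z -> f z = 0) ->
  power_series f c B -> (forall z, normc z < 1 -> bloch_weight f z <= M) ->
  exists g : bloch, bloch_fun g = f /\ bloch_norm g <= normc (c 0%N) + M.
Proof.
move=> f0 fc fM.
have fb : f \in @bloch_pred R.
  apply/asboolP; split=> [z z1|z z1|].
  - by apply: f0; move: z1; rewrite normC_normc -[1]/(1%:C) lecR.
  - by move: z1; rewrite normc_lt1 => z1; have [] := power_series_derive1 fc z1.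
  - by exists M => _ [z /= z1 <-]; apply: fM; rewrite -normc_lt1.
exists (Bloch fb); split=> //.
rewrite /bloch_norm -(power_series_at0 fc) lerD2l.
apply: ge_sup; first exact: bloch_values_neq0.
by move=> _ [z /= z1 <-]; apply: fM; rewrite -normc_lt1.
Qed.

(** Induction on [K]: with $a = 2^K$, the indices from $a$ to $2a-1$ contribute only through the
    coefficient of $z^{2a}$. Its share is at most $2a(1-q)q^{2a-1} \le 2(q^a-q^{2a})$, because $a
    q^{a-1} \le \sum_{i<a} q^i$; these bounds telescope. *)
Lemma lacunary_sum_le c q K : 0 <= q < 1 -> (forall m, normc (c m) <= 1) ->
  (forall m, (0 < m)%N -> (forall k, m != 2 ^ k)%N -> c m = 0) ->
  (1 - q) * (\sum_(m < 2 ^ K) normc (dcoef c m) * q ^+ m) <= 2 * (1 - q ^+ (2 ^ K)).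
Proof.
move=> /andP[q0 q1] c1 c0; have q1' : 0 <= 1 - q by rewrite subr_ge0 ltW.
have dE m : normc (dcoef c m) = m.+1%:R * normc (c m.+1).
  by rewrite /dcoef normcM normc_nat.
elim: K => [|K IH].
  rewrite expn0 big_ord1 expr0 expr1 mulr1 dE mul1r mulrC ler_wpM2r//.
  by rewrite (le_trans (c1 _))// ler1n.
pose a := (2 ^ K)%N; have a0 : (0 < a)%N by rewrite expn_gt0.
have aa : (2 ^ K.+1 = (a + a.-1).+1)%N by rewrite expnS mul2n -addnn -/a -addnS prednK.
rewrite -(big_mkord xpredT (fun m => normc (dcoef c m) * q ^+ m)) aa.
rewrite big_nat_recr//= (@big_cat_nat _ _ _ a)//= ?leq_addr// big_mkord.
rewrite [X in _ + X + _]big_nat_cond [X in _ + X + _]big1 ?addr0; last first.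
  move=> m /andP[/andP[am ma] _]; rewrite dE c0 ?normc0 ?mulr0 ?mul0r// => k.
  apply/eqP => mk.
  have : (2 ^ K < 2 ^ k)%N by rewrite -mk ltnS.
  have : (2 ^ k < 2 ^ K.+1)%N by rewrite -mk aa ltnS.
  by rewrite !ltn_exp2l//; lia.
rewrite mulrDr -aa (le_trans (lerD IH (lexx _)))//.
have -> : 2 * (1 - q ^+ (2 ^ K.+1)) =
    2 * (1 - q ^+ (2 ^ K)) + 2 * (q ^+ a * (1 - q ^+ a)).
  by rewrite expnS mul2n -addnn exprD -/a; ring.
rewrite lerD2l dE -aa.
rewrite (_ : 1 - q ^+ a = (1 - q) * \sum_(i < a) q ^+ i); last first.
  by rewrite -opprB subrX1 -mulNr opprB.
have S : a%:R * q ^+ a.-1 <= \sum_(i < a) q ^+ i.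
  rewrite -[X in X%:R * _]card_ord -sum1_card natr_sum mulr_suml.
  apply: ler_sum => i _; rewrite mul1r ler_wiXn2l// ?ltW//.
  by rewrite -ltnS prednK.
rewrite exprD (_ : 2 ^ K.+1 = 2 * a)%N ?expnS// natrM.
rewrite (_ : _ * _ = (1 - q) * (2 * q ^+ a) * (a%:R * q ^+ a.-1 * normc (c (2 * a)%N)));
  last by ring.
rewrite [leRHS](_ : _ = (1 - q) * (2 * q ^+ a) * (\sum_(i < a) q ^+ i)); last by ring.
rewrite ler_wpM2l ?mulr_ge0 ?exprn_ge0// (le_trans _ S)//.
by rewrite ler_piMr ?mulr_ge0 ?exprn_ge0.
Qed.

End bloch_power_series.

(* On norms of distinct vectors [lra] may diverge while trying to unify them by
   unfolding. *)
Ltac lra_atoms := clear; repeat match goal with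
  | |- context [@bloch_norm ?R ?f] => generalize (@bloch_norm R f)
  | |- context [@normc ?R ?z] => generalize (@normc R z)
  end; intros; lra.

(** * Lacunary Bloch functions, division by z, and limits of power series *)

Section bloch_division.
Variable R : realType.
Local Notation C := R[i].
Local Notation bloch := (bloch R).
Implicit Types (f g : C -> C) (c b : nat -> C) (z w h : C) (B q s r M : R).

(** Since $1-|z|^2 \le 2(1-|z|)$, [lacunary_sum_le] bounds the Bloch weight by 4. *)
Lemma lacunary_bloch c : (forall m, normc (c m) <= 1) ->
  (forall m, (0 < m)%N -> (forall k, m != 2 ^ k)%N -> c m = 0) ->
  exists g : bloch, power_series g c 1.
Proof.
move=> c1 c0.
have [f [f0 fc]] := power_series_exists c1.
have [|g [gf _]] := bloch_of_power_series (M := 4) f0 fc; last first.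
  by exists g; rewrite gf.
move=> z z1; have z01 : 0 <= normc z < 1 by rewrite normc_ge0.
have w0 : 0 < 1 - normc z ^+ 2 by rewrite subr_gt0 expr_lt1 ?normc_ge0.
rewrite /bloch_weight mulrC -ler_pdivlMr//.
apply: (derive1_le_psum fc z1) => K; exists (2 ^ K)%N.
  by rewrite ltnW// ltn_expl.
rewrite ler_pdivlMr//.
apply: (@le_trans _ _ ((\sum_(m < 2 ^ K) normc (dcoef c m) * normc z ^+ m)
    * (2 * (1 - normc z)))).
  rewrite ler_pM ?normc_ge0 ?(ltW w0)//.
    rewrite /psum (le_trans (ler_normc_sum _ _ _))// ler_sum// => i _.
    by rewrite normcM normcX.
  rewrite (_ : 1 - _ = (1 - normc z) * (1 + normc z)); last by ring.
  by rewrite mulrC ler_wpM2r//; lra.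
have := lacunary_sum_le K z01 c1 c0.
have : 0 <= normc z ^+ (2 ^ K) by rewrite exprn_ge0 ?normc_ge0.
set S := \sum_(_ < _) _; lra.
Qed.

Lemma derive1_mulX f z : derivable f z 1 ->
  derive1 (fun w => w * f w) z = f z + z * derive1 f z.
Proof.
move=> dfz; rewrite !derive1E (@deriveM C C id f z 1 (@derivable_id C C z 1) dfz).
by rewrite derive_id [f z *: _]mulr1 [RHS]addrC.
Qed.

(** In $(zf)' = f(0) + (f - f(0)) + zf'$ the last two terms cost one supremum each, the former by
    [bloch_growth]. *)
Lemma bloch_shift_norm_le (f : bloch) :
  bloch_norm (bloch_shift f) <= 2 * bloch_norm f.
Proof.
rewrite {1}/bloch_norm /= mul0r normc0 add0r.
apply: ge_sup; first exact: bloch_values_neq0.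
move=> _ [z /= z1 <-]; have := z1; rewrite normc_lt1 => nz1.
have pz := one_minus_sq_ge0 nz1.
rewrite /bloch_weight derive1_mulX; last exact: bloch_derivable.
have G := bloch_growth f z1.
have W := bloch_weight_le_sup f z1; rewrite /bloch_weight in W.
have E1 : normc (f z) <= normc (f 0) + normc (f z - f 0) by exact: ler_normc_distl.
have E2 : normc (z * derive1 f z) <= normc (derive1 f z).
  by rewrite normcM ler_piMl ?normc_ge0// ltW.
have E3 := ler_normcD (f z) (z * derive1 f z).
have E4 := normc_ge0 (f 0); have E5 := sqr_ge0 (normc z).
rewrite /bloch_norm; set a := 1 - _ in pz W G *.
apply: (@le_trans _ _ (a * (normc (f 0) + normc (f z - f 0) + normc (derive1 f z)))).
  by rewrite ler_wpM2l//; lra.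
have : a * normc (f 0) <= normc (f 0) by rewrite ler_piMl// /a; lra.
by rewrite !mulrDr; lra.
Qed.

Lemma le_double (x p N : R) : 2^-1 < x -> 0 <= p -> x * p <= N -> p <= 2 * N.
Proof.
by move=> x2 p0 xp; rewrite -ler_pdivrMl// (le_trans _ xp)// ler_wpM2r// ltW.
Qed.

(** This makes division by $z$ bounded. Near 0 the coefficient bound controls $f'$; away from 0, $f
    = y/z$ and $zf' = y' - f$ lose only factors of 2. *)
Lemma unshift_weight_le (y : bloch) f c B : power_series f c B ->
  (forall z, y z = z * f z) ->
  forall z, normc z < 1 -> bloch_weight f z <= 16 * bloch_norm y.
Proof.
move=> fc yf z z1.
have cy m : normc (c m) <= 4 * bloch_norm y.
  have /bloch_coef_le /(_ m.+1) := power_series_ext (fun z _ => esym (yf z))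
    (power_series_shift fc).
  by [].
have pz := one_minus_sq_ge0 z1; have N0 := bloch_norm_ge0 y.
have [z2|z2] := leP (normc z) 2^-1.
  (* The coefficients are at most $4\|y\|$ and $\sum (m+1)2^{-m} \le 4$, whence 16. *)
  have : normc (derive1 f z) <= 16 * bloch_norm y.
    apply: (derive1_le_psum fc z1) => L; exists L => //.
    apply: le_trans (ler_normc_sum _ _ _) _.
    apply: (@le_trans _ _ (4 * bloch_norm y * \sum_(m < L) m.+1%:R * 2^-1 ^+ m)).
      rewrite mulr_sumr ler_sum// => m _.
      rewrite /dcoef !normcM normc_nat normcX mulrA [4 * _ * _]mulrC.
      rewrite ler_pM ?mulr_ge0 ?exprn_ge0 ?normc_ge0 ?ler_wpM2l//.
      by rewrite lerXn2r ?nnegrE ?normc_ge0 ?invr_ge0.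
    have := @weighted_sum1_le R 2^-1 L.
    rewrite (_ : (1 - 2^-1)^-1 ^+ 2 = 4); last by field.
    rewrite (_ : 16 * _ = 4 * bloch_norm y * 4); last by ring.
    by move=> H; rewrite ler_wpM2l ?mulr_ge0//; apply: H; apply/andP; split; lra.
  move=> H; rewrite /bloch_weight (le_trans _ H)// ler_piMl ?normc_ge0//.
  by rewrite gerBl sqr_ge0.
have yE : bloch_fun y = (fun w => w * f w) by exact: funext.
have [df _] := power_series_derive1 fc z1.
have dy := derive1_mulX df; rewrite -yE in dy.
have W := bloch_weight_le_norm y z1; rewrite /bloch_weight in W.
have := bloch_growth y (z := z); rewrite normc_lt1 => /(_ z1).
rewrite (yf 0) mul0r subr0 => G; have {}G := le_trans G (bloch_sup_le_norm y).
rewrite /bloch_weight; set a := 1 - _ in pz W G *.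
have E : normc z * normc (derive1 f z) <= normc (derive1 y z) + normc (f z).
  rewrite -normcM -[normc (f z)]normcN.
  by rewrite (_ : z * _ = derive1 y z - f z) ?ler_normcD// dy addrAC subrr add0r.
rewrite yf normcM in G.
have f0 := normc_ge0 (f z); have d0 := normc_ge0 (derive1 f z).
(* Dividing by $|z| > 1/2$ gives the constant 2 for $f$, then $2(1+2) = 6$ for $f'$, which is below
   16. *)
have H1 : a * normc (f z) <= 2 * bloch_norm y.
  by apply: (le_double z2); rewrite ?mulr_ge0// mulrCA.
have H2 : normc z * (a * normc (derive1 f z)) <= 3 * bloch_norm y.
  rewrite mulrCA (le_trans (ler_wpM2l pz E))// mulrDr; move: W H1; lra_atoms.
have H3 := le_double z2 (mulr_ge0 pz d0) H2.
by rewrite (le_trans H3)// mulrA ler_wpM2r// -natrM ler_nat.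
Qed.

Lemma bloch_eq0_out (y : bloch) z : 1 <= normc z -> y z = 0.
Proof.
by move=> z1; have [-> //] := blochP y; rewrite normC_normc -[1]/(1%:C) lecR.
Qed.

(** The constant 20 is 4 for $h(0) = c_1$ plus 16 for the weight. *)
Lemma bloch_divide (y : bloch) c B : power_series y c B -> c 0%N = 0 ->
  exists h : bloch, [/\ bloch_shift h = y,
    power_series h (fun m => c m.+1) B & bloch_norm h <= 20 * bloch_norm y].
Proof.
move=> yc c0.
have [f [f0 fc]] := power_series_exists (fun m => yc.1 m.+1).
have yf z : y z = z * f z.
  have [z1|z1] := leP 1 (normc z); first by rewrite f0// mulr0 bloch_eq0_out.
  apply: (@power_series_eq _ _ (fun w => w * f w) _ _ B yc _ z z1).
  rewrite (_ : c = fun m => if m is m'.+1 then c m'.+1 else 0).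
    exact: power_series_shift.
  by apply/funext => -[|m].
have [h [hf hn]] := bloch_of_power_series f0 fc (unshift_weight_le fc yf).
exists h; split; rewrite ?hf//.
  by apply/val_inj/funext => z /=; rewrite hf yf.
rewrite (le_trans hn)// (_ : 20 * _ = 4 * bloch_norm y + 16 * bloch_norm y).
  by rewrite lerD2r; exact: bloch_coef_le yc 1.
by rewrite -mulrDl -natrD.
Qed.

Lemma power_series_lin a (f g : bloch) c b B B' :
  power_series f c B -> power_series g b B' ->
  power_series (a *: f + g : bloch) (fun m => a * c m + b m) (normc a * B + B').
Proof. exact: power_seriesD. Qed.

Lemma power_series_bloch_shift (f : bloch) c B : power_series f c B ->
  power_series (bloch_shift f) (fun m => if m is m'.+1 then c m' else 0) B.
Proof. exact: power_series_shift. Qed.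

Lemma power_seriesB (f g : bloch) c b B B' :
  power_series f c B -> power_series g b B' ->
  power_series (f - g : bloch) (fun m => c m - b m) (B' + B).
Proof.
move=> fc gb; have := power_series_lin (-1) gb fc.
rewrite scaleN1r addrC (_ : normc (-1 : C) = 1) ?normcN ?normc1// mul1r.
rewrite (_ : (fun m => _) = (fun m => c m - b m))//.
by apply/funext => m; rewrite mulN1r addrC.
Qed.

Lemma bloch_value_le (f : bloch) z : normc z < 1 ->
  normc (f z) <= bloch_norm f * (1 + (1 - normc z ^+ 2)^-1).
Proof.
move=> z1; have pz : 0 < 1 - normc z ^+ 2 by rewrite subr_gt0 expr_lt1 ?normc_ge0.
rewrite (le_trans (ler_normc_distl _ (f 0)))// mulrDr mulr1 lerD ?bloch_at0_le_norm//.
rewrite ler_pdivlMr// mulrC (le_trans (bloch_growth _ _)) ?bloch_sup_le_norm//.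
by rewrite normc_lt1.
Qed.

Lemma bloch_normN (f : bloch) : bloch_norm (- f) = bloch_norm f.
Proof. by rewrite -scaleN1r bloch_normZ normcN normc1 mul1r. Qed.

Lemma bloch_distC (f g : bloch) : bloch_norm (f - g) = bloch_norm (g - f).
Proof. by rewrite -bloch_normN opprB. Qed.

Lemma bloch_dist_triangle (f g h : bloch) :
  bloch_norm (f - g) <= bloch_norm (h - f) + bloch_norm (h - g).
Proof.
have -> : f - g = (h - g) + - (h - f) by rewrite opprB [RHS]addrC subrKA.
apply: le_trans (bloch_normD _ _) _.
rewrite bloch_normN.
by rewrite [leLHS]addrC.
Qed.

(** The coefficient $c_m$ of the limit is a common centre of the $m$-th coefficients of all [d]
    having a power series, with radii $4\|x-d\|$ given by [bloch_coef_le]. The expansion of [x]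
    follows by comparison with a sufficiently close [d]. *)
Lemma power_series_closed (x : bloch) :
  (forall e, 0 < e -> exists2 d : bloch, exists c B, power_series d c B &
    bloch_norm (x - d) <= e) ->
  exists c B, power_series x c B.
Proof.
move=> xe.
pose I := {p : bloch * (nat -> C) | exists B, power_series p.1 p.2 B}.
have [d0 [c0 [B0 dc0]] de0] := xe 1 ltr01.
pose i0 : I := exist _ (d0, c0) (ex_intro _ B0 dc0).
have [m|c cE] := choice (fun m =>
  @complex_center R I i0 (fun i => (sval i).2 m)
    (fun i => 4 * bloch_norm (x - (sval i).1)) _).
  move=> [[d b] [B db]] [[d' b'] [B' db']] /=.
  have /= := bloch_coef_le (power_seriesB db db') m.
  have := bloch_dist_triangle d d' x; lra_atoms.
(* [B] has to bound every $c_m$ and also $4\|x\|$; the 8 is twice the radius constant 4. *)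
pose B := 8 * bloch_norm (x - d0) + 4 * bloch_norm d0.
have cB m : normc (c m) <= B.
  have := cE m i0; rewrite /i0/= distcC => H.
  have := bloch_coef_le dc0 m; have := ler_normc_distl (c m) (c0 m).
  by move: H; rewrite /B; lra_atoms.
exists c, B; split=> // z L z1.
have z01 : 0 <= normc z < 1 by rewrite normc_ge0.
have pz : 0 < 1 - normc z by rewrite subr_gt0.
have pz2 : 0 < 1 - normc z ^+ 2 by rewrite subr_gt0 expr_lt1 ?normc_ge0.
have xB : 4 * bloch_norm x <= B.
  have := bloch_norm_ge0 (x - d0); have := bloch_normD (x - d0) d0.
  by rewrite subrK /B; lra_atoms.
(* [K] collects the factors of [e] in three comparisons: $x(z)$ with $d(z)$, $d(z)$ with its partial
   sum, and the two partial sums with each other. *)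
pose K := 1 + (1 - normc z ^+ 2)^-1 + 12 / (1 - normc z).
have K0 : 0 < K by rewrite /K !addr_gt0 ?divr_gt0 ?invr_gt0.
apply/ler_addgt0Pl => eta eta0.
have [d [b [B' db]] de] := xe (eta / K) (divr_gt0 eta0 K0).
set e := eta / K in de; have e0 : 0 < e by exact: divr_gt0.
have eK : e * K = eta by rewrite divfK ?gt_eqF.
clearbody e.
have -> : eta = e * (1 + (1 - normc z ^+ 2)^-1) + 4 * e / (1 - normc z)
    + 8 * e / (1 - normc z).
  by rewrite -eK /K; ring.
have E1 : normc (x z - d z) <= e * (1 + (1 - normc z ^+ 2)^-1).
  rewrite (le_trans (bloch_value_le (x - d) z1))// ler_wpM2r//.
  by rewrite addr_ge0// invr_ge0 ltW.
have E2 : normc (d z - psum b L z) <=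
    4 * e / (1 - normc z) + B / (1 - normc z) * normc z ^+ L.
  apply: le_trans ((power_series_bound db (bloch_coef_le db)).2 _ _ z1) _.
  have dx : 4 * bloch_norm d <= B + 4 * e.
    have := bloch_normD x (d - x); rewrite subrKC (bloch_distC d); move: de xB; lra_atoms.
  apply: (@le_trans _ _ ((B + 4 * e) / (1 - normc z) * normc z ^+ L)).
    by rewrite ler_wpM2r ?exprn_ge0 ?normc_ge0// ler_wpM2r// invr_ge0 ltW.
  rewrite mulrDl mulrDl addrC lerD2r ler_piMr//.
    by rewrite divr_ge0 ?ltW// mulr_gt0.
  by rewrite exprn_ile1 ?normc_ge0// ltW.
have E3 : normc (psum b L z - psum c L z) <= 8 * e / (1 - normc z).
  rewrite /psum -sumrB (le_trans (ler_normc_sum _ _ _))//.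
  apply: (@le_trans _ _ (\sum_(i < L) 8 * e * normc z ^+ i)).
    apply: ler_sum => m _; rewrite -mulrBl normcM normcX.
    rewrite ler_wpM2r ?exprn_ge0 ?normc_ge0//.
    apply: le_trans (cE m (exist _ (d, b) (ex_intro _ B' db))) _.
    by rewrite /= (_ : 8 * e = 2 * (4 * e)) ?ler_wpM2l//; ring.
  rewrite -mulr_sumr ler_wpM2l ?mulr_ge0 ?(ltW e0)//.
  rewrite -(big_mkord xpredT (fun i => normc z ^+ i)).
  by have := geometric_sum_le 0 L z01; rewrite expr0 mul1r.
rewrite (le_trans (ler_distcD _ (d z) _))//.
rewrite (le_trans (lerD (lexx _) (ler_distcD _ (psum b L z) _)))//.
by move: E1 E2 E3; lra_atoms.
Qed.

End bloch_division.

(** * The lacunary subspace *)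

Section lacunary_space.
Variable R : realType.
Local Notation C := R[i].
Local Notation bloch := (bloch R).
Implicit Types (N : option nat) (c b : nat -> C) (P Q : nat -> nat -> C).

(* [P i s] is the coefficient of [z ^ s] in the polynomial of label [i]; label 0
   only records the constant term of the series. *)
Definition lacunary_pattern N c P : Prop :=
  [/\ forall n, N = Some n -> forall j s, (n <= j)%N -> P j s = 0,
      c 0%N = P 0%N 0%N
    & exists d, (forall j s, (d <= s)%N -> P j s = 0) /\
        forall K s, (d <= K)%N -> (s < 2 ^ K)%N ->
          c (2 ^ K + s)%N = P (logn 2 K).+1 s].

Definition has_pattern N (g : bloch) P : Prop :=
  exists c B, power_series g c B /\ lacunary_pattern N c P.

Lemma has_pattern0 N : has_pattern N 0 (fun _ _ => 0).
Proof.
exists (fun=> 0), 0; split.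
  split=> [m|z L z1]; first by rewrite normc0.
  by rewrite /psum big1 ?subrr ?normc0 ?mul0r// => i _; rewrite mul0r.
by split=> //; exists 0%N.
Qed.

Lemma has_pattern_lin N a (f g : bloch) P Q : has_pattern N f P ->
  has_pattern N g Q ->
  has_pattern N (a *: f + g) (fun j s => a * P j s + Q j s).
Proof.
move=> [c [B [fc [PN c0 [d [Pd cP]]]]]] [b [B' [gb [QN b0 [e [Qe bQ]]]]]].
exists (fun m => a * c m + b m), (normc a * B + B').
split; first exact: power_series_lin.
split=> [n Nn j s nj||].
- by rewrite (PN n)// (QN n)// mulr0 addr0.
- by rewrite c0 b0.
- exists (maxn d e); split=> [j s|K s]; rewrite geq_max => /andP[ds es].
    by rewrite Pd// Qe// mulr0 addr0.
  by move=> sK; rewrite cP// bQ.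
Qed.

Lemma has_patternB N (f g : bloch) P Q : has_pattern N f P ->
  has_pattern N g Q -> has_pattern N (f - g) (fun j s => P j s - Q j s).
Proof.
move=> fP gQ; have := has_pattern_lin (-1) gQ fP.
rewrite scaleN1r [- g + f]addrC.
by congr (has_pattern _ _ _); apply/funext => j; apply/funext => s; rewrite mulN1r addrC.
Qed.

Lemma has_pattern_sum N n (a : 'I_n -> C) (f : 'I_n -> bloch) (P : 'I_n -> nat -> nat -> C) :
  (forall i, has_pattern N (f i) (P i)) ->
  has_pattern N (\sum_i a i *: f i) (fun j s => \sum_i a i * P i j s).
Proof.
elim: n a f P => [|n IH] a f P fP.
  rewrite big_ord0; have := has_pattern0 N; congr has_pattern.
  by apply/funext => j; apply/funext => s; rewrite big_ord0.
rewrite big_ord_recl.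
have := has_pattern_lin (a ord0) (fP ord0)
  (IH (a \o lift ord0) (f \o lift ord0) (P \o lift ord0) (fun i => fP (lift ord0 i))).
congr has_pattern.
by apply/funext => j; apply/funext => s; rewrite big_ord_recl.
Qed.

(** Each $P_j$ becomes $zP_j$, so all the constant terms vanish. *)
Lemma has_pattern_shift N (f : bloch) P : has_pattern N f P ->
  has_pattern N (bloch_shift f) (fun j s => if s is s'.+1 then P j s' else 0).
Proof.
move=> [c [B [fc [PN c0 [d [Pd cP]]]]]].
exists (fun m => if m is m'.+1 then c m' else 0), B.
split; first exact: power_series_bloch_shift.
split=> //; first by move=> n Nn j [|s] nj//; exact: (PN n).
exists d.+1; split=> [j [|s] ds//|]; first exact: Pd.
move=> [//|K] [|s]; rewrite ltnS => dK sK; last first.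
  by rewrite addnS cP// ?(leqW dK)// (ltn_trans _ sK).
(* The coefficient at the start of a block comes from the last exponent of the preceding block,
   where the offset $2^K-1 \ge d$ makes it 0. *)
have k0 : (0 < 2 ^ K)%N by rewrite expn_gt0.
rewrite addn0 expnS mul2n -addnn -(prednK k0) addnS prednK//.
have dk : (d <= (2 ^ K).-1)%N by rewrite -ltnS prednK// (leq_ltn_trans dK)// ltn_expl.
by rewrite cP ?prednK// Pd.
Qed.

Lemma normc_pattern_le N (g : bloch) P : has_pattern N g P ->
  forall i, normc (P i 0%N) <= 4 * bloch_norm g.
Proof.
move=> [c [B [gc [_ c0 [d [_ cP]]]]]] [|i].
  by rewrite -c0; exact: (bloch_coef_le gc).
(* The cofactor of $2^i$ is odd, so [K] has label $i+1$; it also makes $K \ge d$. *)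
pose K := (2 ^ i * (2 * d).+1)%N.
have Ki : logn 2 K = i.
  by rewrite /K lognM ?expn_gt0// pfactorK// lognE/= dvdn2 /= mul2n odd_double addn0.
rewrite -{1}Ki -(cP K) ?expn_gt0//.
  exact: (bloch_coef_le gc).
rewrite /K (leq_trans (_ : d <= (2 * d).+1)%N) ?leq_pmull ?expn_gt0//.
by rewrite mul2n -addnn leqW// leq_addr.
Qed.

Definition monomial_pattern (i j s : nat) : C := ((j == i) && (s == 0%N))%:R.

(** [trunc_log] recovers $K$ from $2^K$. For [i] equal to 0 this is the sequence of the constant 1,
    as every $2^K$ has a positive label. *)
Definition lacunary_coef (i m : nat) : C :=
  if m == 0%N then (i == 0%N)%:R
  else ((m == 2 ^ trunc_log 2 m)%N && ((logn 2 (trunc_log 2 m)).+1 == i))%:R.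

Lemma lacunary_bloch_exists i : exists g : bloch,
  forall N, (forall n, N = Some n -> (i < n)%N) ->
  has_pattern N g (monomial_pattern i).
Proof.
have [||g gc] := @lacunary_bloch R (lacunary_coef i).
- by move=> m; rewrite /lacunary_coef; case: ifP => _; rewrite normc_nat lern1 leq_b1.
- move=> m m0 mk; by rewrite /lacunary_coef (gtn_eqF m0) (negPf (mk _)).
exists g => N iN; exists (lacunary_coef i), 1; split=> //; split.
- move=> n Nn j s nj; rewrite /monomial_pattern.
  by rewrite (gtn_eqF (leq_trans (iN n Nn) nj)).
- by rewrite /lacunary_coef/= /monomial_pattern andbT eq_sym.
exists 1%N; split=> [j s s0|K s K0 sK].
  by rewrite /monomial_pattern (gtn_eqF s0) andbF.
have tK : trunc_log 2 (2 ^ K + s) = K.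
  apply: trunc_log_eq => //; rewrite leq_addr expnS mul2n -addnn/=.
  by rewrite ltn_add2l.
rewrite /lacunary_coef tK addn_eq0 expn_eq0/= /monomial_pattern.
by rewrite -[X in _ == X]addn0 eqn_add2l andbC.
Qed.

Lemma bloch_ext (f g : bloch) : (forall z, normc z < 1 -> f z = g z) -> f = g.
Proof.
move=> fg; apply/val_inj/funext => z /=.
by have [z1|/fg//] := leP 1 (normc z); rewrite !bloch_eq0_out.
Qed.

(** Division by $z$ moves every coefficient one place down. Patterns survive because the coefficient
    pushed into the preceding block is some $P_j(0) = 0$. *)
Lemma has_pattern_unshift N (g : bloch) P : N <> Some 0%N ->
  has_pattern N g P -> (forall i, P i 0%N = 0) ->
  exists h : bloch, bloch_shift h = g /\ exists Q, has_pattern N h Q.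
Proof.
move=> N0 [c [B [gc [PN c0 [d [Pd cP]]]]]] P0.
have [h [hg hc _]] := bloch_divide gc (etrans c0 (P0 0%N)).
exists h; split=> //.
(* Label 0 now records the new constant term $c_1$, possibly nonzero; this is where [N] must differ
   from [Some 0]. *)
exists (fun j s => if j == 0%N then (if s == 0%N then c 1%N else 0) else P j s.+1).
exists (fun m => c m.+1), B; split=> //; split=> //.
- move=> n Nn j s nj; have : (0 < n)%N.
    by rewrite lt0n; apply/eqP => n0; apply: N0; rewrite Nn n0.
  by move=> n0; rewrite (gtn_eqF (leq_trans n0 nj)) (PN n).
- exists d.+1; split=> [j [//|s] ds|K s dK sK].
    by rewrite Pd ?if_same// (leq_trans (ltnW ds)).
  rewrite /= -addnS; have [sK'|sK'] := ltnP s.+1 (2 ^ K); first by rewrite cP// ltnW.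
  (* The last place of the block receives the first coefficient of the next block. *)
  have -> : s.+1 = (2 ^ K)%N by apply/eqP; rewrite eqn_leq sK.
  rewrite addnn -mul2n -expnS -[(2 ^ K.+1)%N]addn0 cP ?expn_gt0 ?P0// ?Pd//.
    by rewrite (leq_trans (ltnW dK))// ltnW// ltn_expl.
  by rewrite (leq_trans (ltnW dK)).
Qed.

Lemma bloch_shift_is_linear : linear (@bloch_shift R).
Proof.
move=> a f g; apply/val_inj/funext => z /=.
by rewrite -[LHS]/(z * (a * f z + g z)) mulrDr mulrCA.
Qed.

End lacunary_space.

HB.instance Definition _ (R : realType) :=
  GRing.isLinear.Build R[i] (bloch R) (bloch R) *:%R (@bloch_shift R)
    (@bloch_shift_is_linear R).

(** * The closure as a closed invariant subspace *)

Section lacunary_closure.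
Variable R : realType.
Local Notation C := R[i].
Local Notation bloch := (bloch R).
Implicit Types (N : option nat) (P Q : nat -> nat -> C).

Lemma bloch_closureP (A : set bloch) (x : bloch) : closure A x <->
  forall e : R, 0 < e -> exists2 d, A d & bloch_norm (x - d) < e.
Proof.
have ballE (e : R) y : ball x e%:C y = (bloch_norm (x - y) < e) :> Prop.
  by rewrite -ball_normE /= -[`|x - y|]/((bloch_norm (x - y))%:C) ltcR.
split=> [xA e e0|xA B /nbhs_ballP[e e0 eB]].
  have [|d [Ad]] := xA (ball x e%:C); last by rewrite ballE => de; exists d.
  by apply: nbhsx_ballx; rewrite -[0]/(0%:C) ltcR.
(* A positive element of [R[i]] is real, so complex radii reduce to real ones. *)
have : 0 < e := e0; rewrite ltcE/= => /andP[/eqP ie re].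
have eE : e = (complex.Re e)%:C by case: (e) ie => a b /= ->.
have [d Ad de] := xA _ re; exists d; split=> //.
by apply: eB; rewrite eE ballE.
Qed.

Definition lacunary_span N : set bloch := [set g | exists P, has_pattern N g P].

Definition lacunary_closure N : set bloch := closure (lacunary_span N).

Lemma lacunary_closureP N x : lacunary_closure N x <->
  forall e : R, 0 < e -> exists d P, has_pattern N d P /\ bloch_norm (x - d) < e.
Proof.
rewrite /lacunary_closure bloch_closureP; split=> xe e /xe.
  by move=> [d [P dP] de]; exists d, P.
by move=> [d [P [dP de]]]; exists d => //; exists P.
Qed.

Lemma lacunary_span_sub N x P : has_pattern N x P -> lacunary_closure N x.
Proof. by move=> xP; apply: subset_closure; exists P. Qed.

Lemma lacunary_closure_lin N a (x y : bloch) : lacunary_closure N x ->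
  lacunary_closure N y -> lacunary_closure N (a *: x + y).
Proof.
move=> /lacunary_closureP xE /lacunary_closureP yE; apply/lacunary_closureP => e e0.
have K0 : 0 < normc a + 1 by rewrite ltr_wpDl// normc_ge0.
have [d [P [dP de]]] := xE (e / 2 / (normc a + 1)) (divr_gt0 (divr_gt0 e0 (ltr0Sn _ 1)) K0).
have [d' [P' [dP' de']]] := yE (e / 2) (divr_gt0 e0 (ltr0Sn _ 1)).
exists (a *: d + d'), (fun j s => a * P j s + P' j s).
split; first exact: has_pattern_lin.
have -> : a *: x + y - (a *: d + d') = a *: (x - d) + (y - d').
  by rewrite scalerBr opprD addrACA.
rewrite (le_lt_trans (bloch_normD _ _))// bloch_normZ [ltRHS](splitr e) ler_ltD//.
move: de; rewrite ltr_pdivlMr// => /ltW; apply: le_trans.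
by rewrite mulrC ler_wpM2l ?bloch_norm_ge0// lerDl.
Qed.

Lemma lacunary_closure_submod N : submod_closed (mem (lacunary_closure N)).
Proof.
split; first by rewrite inE; exact: lacunary_span_sub (has_pattern0 R N).
by move=> a x y; rewrite !inE; exact: lacunary_closure_lin.
Qed.

Lemma lacunary_closure_sum N n (a : 'I_n -> C) (x : 'I_n -> bloch) :
  (forall i, lacunary_closure N (x i)) -> lacunary_closure N (\sum_i a i *: x i).
Proof.
move=> xE; elim/big_ind: _ => [|u v uE vE|i _].
- exact: lacunary_span_sub (has_pattern0 R N).
- by rewrite -[u]scale1r; exact: lacunary_closure_lin.
- rewrite -[_ *: _]addr0; apply: lacunary_closure_lin => //.
  exact: lacunary_span_sub (has_pattern0 R N).
Qed.

Lemma lacunary_closure_shift N x : lacunary_closure N x ->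
  lacunary_closure N (bloch_shift x).
Proof.
move=> /lacunary_closureP xE; apply/lacunary_closureP => e e0.
have [d [P [dP de]]] := xE (e / 2) (divr_gt0 e0 (ltr0Sn _ 1)).
exists (bloch_shift d); eexists; split; first exact: has_pattern_shift dP.
rewrite -linearB/= (le_lt_trans (bloch_shift_norm_le _))//.
by rewrite mulrC -ltr_pdivlMr.
Qed.

(** This provides the expansion that [bloch_divide] requires of elements of the closure. *)
Lemma lacunary_closure_power_series N x : lacunary_closure N x ->
  exists c B, power_series x c B.
Proof.
move=> /lacunary_closureP xE; apply: power_series_closed => e /xE.
by move=> [d [P [[c [B [dc _]]] /ltW de]]]; exists d => //; exists c, B.
Qed.

Lemma lacunary_closure_invariant N :
  closed_invariant_subspace (lacunary_closure N).
Proof.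
split; first exact: lacunary_closure_submod.
  exact: closed_closure.
by move=> _ [x xE <-]; exact: lacunary_closure_shift.
Qed.

(** If $x = zh$ and [d] in the span is close to [h], then $x - zd$ still has the constant terms
    $P_i(0)$, which are at most $4\|z(h-d)\| \le 8\|h-d\|$. *)
Lemma pattern_shift_eq0 N x P : has_pattern N x P ->
  (@bloch_shift R @` lacunary_closure N) x -> forall i, P i 0%N = 0.
Proof.
move=> xP [h /lacunary_closureP hE hx] i.
apply/eq0_normc/eqP; rewrite eq_le normc_ge0 andbT; apply/ler_addgt0Pl => e e0.
have [d [Q [dQ de]]] := hE (e / 8) (divr_gt0 e0 (ltr0Sn _ 7)).
have := normc_pattern_le (has_patternB xP (has_pattern_shift dQ)) i.
rewrite subr0 addr0 => /le_trans; apply.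
rewrite -hx -linearB/= (le_trans (ler_wpM2l _ (bloch_shift_norm_le _)))//.
by rewrite mulrA -natrM mulrC -ler_pdivlMr// ltW.
Qed.

(** * Independence and spanning modulo the shift *)

Variable basis : nat -> bloch.
Hypothesis basisP : forall i N, (forall n, N = Some n -> (i < n)%N) ->
  has_pattern N (basis i) (monomial_pattern R i).

Lemma sum_monomial_pattern n (a : 'I_n -> C) (i : 'I_n) :
  \sum_j a j * monomial_pattern R j i 0 = a i.
Proof.
rewrite (bigD1 i)//= /monomial_pattern !eqxx mulr1 big1 ?addr0// => j ji.
by rewrite (inj_eq val_inj) eq_sym (negPf ji) mulr0.
Qed.

Lemma basis_free N n (a : 'I_n -> C) :
  (forall (i : 'I_n) m, N = Some m -> (i < m)%N) ->
  (@bloch_shift R @` lacunary_closure N) (\sum_i a i *: basis i) ->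
  forall i, a i = 0.
Proof.
move=> iN aE i.
have := pattern_shift_eq0 (has_pattern_sum a (fun i : 'I_n => basisP (iN i))) aE i.
by rewrite sum_monomial_pattern.
Qed.

(** If [d] in the span satisfies $\|y - zd\| \le \epsilon$, division by $z$ gives $\|y/z - d\| \le
    20\epsilon$; thus $y/z$ lies in the closure. *)
Lemma lacunary_divide N (y : bloch) : N <> Some 0%N -> lacunary_closure N y ->
  (forall e : R, 0 < e -> exists h Q, has_pattern N h Q /\
    bloch_norm (y - bloch_shift h) <= e) ->
  (@bloch_shift R @` lacunary_closure N) y.
Proof.
move=> N0 /lacunary_closure_power_series[c [B yc]] yE.
have c0 : c 0%N = 0.
  rewrite -(power_series_at0 yc); apply/eq0_normc/eqP.
  rewrite eq_le normc_ge0 andbT; apply/ler_addgt0Pl => e /yE[h [_ [_ he]]].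
  rewrite addr0 (le_trans _ he)// (le_trans _ (bloch_at0_le_norm _))//.
  by rewrite -[(y - bloch_shift h) 0]/(y 0 - 0 * h 0) mul0r subr0.
have [h [hy hc _]] := bloch_divide yc c0.
exists h => //; apply/lacunary_closureP => e e0.
(* Taking 40 instead of 20 makes the final inequality strict. *)
have [d [Q [dQ de]]] := yE (e / 40) (divr_gt0 e0 (ltr0Sn _ 39)).
exists d, Q; split=> //.
have [b [B' [db _]]] := dQ.
have [|k [ky kc kn]] := bloch_divide (power_seriesB yc (power_series_bloch_shift db)).
  by rewrite c0 subrr.
have -> : h - d = k.
  apply: bloch_ext => z z1; exact: (power_series_eq (power_seriesB hc db) kc z1).
rewrite (le_lt_trans kn)// (le_lt_trans (ler_wpM2l _ de))// mulrC.
rewrite -mulrA gtr_pMr// mulrC ltr_pdivrMr// mul1r ltr_nat.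
by [].
Qed.

(** The numbers $P_i(0)$ extend from the span to [x] as common centres $a_i$. For [d] in the span
    near [x], $d - \sum P_i(0) b_i$ has vanishing constant terms, so it is divisible by $z$ within
    the span; and it approximates $x - \sum a_i b_i$. *)
Lemma basis_spans n x : (0 < n)%N -> lacunary_closure (Some n) x ->
  exists a : 'I_n -> C, (@bloch_shift R @` lacunary_closure (Some n))
    (x - \sum_i a i *: basis i).
Proof.
move=> n0 xE; have /lacunary_closureP xd := xE.
have iN (i : 'I_n) m : Some n = Some m -> (i < m)%N by move=> [<-].
pose I := {p : bloch * (nat -> nat -> C) | has_pattern (Some n) p.1 p.2}.
have [d0 [P0 [dP0 _]]] := xd 1 ltr01.
pose i0 : I := exist _ (d0, P0) dP0.
have [j|a aE] := choice (fun j : 'I_n =>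
  @complex_center R I i0 (fun i => (sval i).2 j 0%N)
    (fun i => 4 * bloch_norm (x - (sval i).1)) _).
  move=> [[d P] dP] [[d' P'] dP'] /=.
  rewrite (le_trans (normc_pattern_le (has_patternB dP dP') j))//.
  by rewrite -mulrDr ler_wpM2l// bloch_dist_triangle.
exists a; apply: lacunary_divide => [[n00]||e e0].
- by rewrite n00 in n0.
- rewrite addrC -scaleN1r; apply: lacunary_closure_lin => //.
  by apply: lacunary_closure_sum => i; exact: lacunary_span_sub (basisP (iN i)).
(* Each $|P_i(0)-a_i|$ is at most $8\|x-d\|$, so the total error is at most $M\|x-d\|$. *)
pose M := 1 + \sum_(i < n) 8 * bloch_norm (basis i).
have M0 : 0 < M.
  by rewrite ltr_pwDl// sumr_ge0// => i _; rewrite mulr_ge0// bloch_norm_ge0.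
have [d [P [dP de]]] := xd (e / M) (divr_gt0 e0 M0).
pose d' := d - \sum_(i < n) P i 0%N *: basis i.
have dP' := has_patternB dP
  (has_pattern_sum (fun i : 'I_n => P i 0%N) (fun i : 'I_n => basisP (iN i))).
have [||h [hd [Q hQ]]] := has_pattern_unshift _ dP'.
- by move=> [n00]; rewrite n00 in n0.
- move=> i; have [ni|ni] := leqP n i; last first.
    by rewrite (sum_monomial_pattern (fun i : 'I_n => P i 0%N) (Ordinal ni)) subrr.
  have [_ [_ [_ [PN _ _]]]] := dP; rewrite (PN n erefl _ _ ni).
  rewrite big1 ?subrr// => j _; rewrite /monomial_pattern.
  by rewrite (gtn_eqF (leq_trans (ltn_ord j) ni)) mulr0.
exists h, Q; split=> //; rewrite hd.
have -> : x - \sum_i a i *: basis i - (d - \sum_(i < n) P i 0%N *: basis i) =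
    (x - d) + \sum_(i < n) (P i 0%N - a i) *: basis i.
  rewrite [in RHS](eq_bigr (fun i : 'I_n => P i 0%N *: basis i - a i *: basis i)); last first.
    by move=> i _; rewrite scalerBl.
  by rewrite sumrB opprB [X in _ + X = _]addrC addrACA [X in _ + X = _]addrC.
have xd0 := bloch_norm_ge0 (x - d).
rewrite (le_trans (bloch_normD _ _))// (@le_trans _ _ (bloch_norm (x - d) * M))//; last first.
  by rewrite -ler_pdivlMr// ltW.
rewrite mulrDr mulr1 lerD2l mulr_sumr.
elim/big_rec2 : _ => [|i u v _ uv].
  by rewrite -(scale0r (0 : bloch)) bloch_normZ normc0 mul0r.
rewrite (le_trans (bloch_normD _ _))// lerD// bloch_normZ mulrA ler_wpM2r ?bloch_norm_ge0//.
have := aE i (exist _ (d, P) dP).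
by rewrite /= mulrA -natrM mulrC.
Qed.

Lemma lacunary_closure_index N : N <> Some 0%N ->
  has_index (lacunary_closure N) N.
Proof.
case: N => [n|] N0.
  have n0 : (0 < n)%N by rewrite lt0n; apply/eqP => n0; apply: N0; rewrite n0.
  have iN (i : 'I_n) m : Some n = Some m -> (i < m)%N by move=> [<-].
  exists (fun i : 'I_n => basis i); split=> [i|c cE|x xE].
  - exact: lacunary_span_sub (basisP (iN i)).
  - exact: (basis_free iN cE).
  - exact: basis_spans.
(* If $n$ vectors spanned the quotient, the coordinates of $n+1$ of the $b_i$ would form a matrix
   with a nonzero left kernel vector; the corresponding combination lies in $zE$, against
   [basis_free]. *)
move=> [n [b [_ _ bE]]].
have eE (i : 'I_n.+1) : lacunary_closure None (basis i).
  by apply: lacunary_span_sub (basisP _).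
have [A AE] := choice (fun i => bE _ (eE i)).
have [h hE] := choice (fun i => (let: ex_intro2 x Ex hx := AE i in
  ex_intro (fun x => lacunary_closure None x /\ bloch_shift x = _) x (conj Ex hx))).
pose M : 'M[C]_(n.+1, n) := \matrix_(i, j) A i j.
have : kermx M != 0.
  rewrite kermx_eq0 /row_free; apply/eqP => rM.
  by have := rank_leq_col M; rewrite rM ltnn.
move=> /rowV0Pn[v /sub_kermxP vM /negP]; apply; apply/eqP/rowP => i.
rewrite mxE; apply: (@basis_free None n.+1 (fun i => v 0 i)) => //.
exists (\sum_i v 0 i *: h i).
  by apply: lacunary_closure_sum => k; exact: (hE k).1.
rewrite linear_sum/=.
have -> : \sum_k bloch_shift (v 0 k *: h k) =
    \sum_k v 0 k *: basis k - \sum_k \sum_j (v 0 k * A k j) *: b j.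
  rewrite -sumrB; apply: eq_bigr => k _; rewrite linearZ/= (hE k).2 scalerBr.
  by rewrite scaler_sumr; congr (_ - _); apply: eq_bigr => j _; rewrite scalerA.
rewrite exchange_big/= [X in _ - X]big1 ?subr0// => j _.
rewrite -scaler_suml; have -> : \sum_k v 0 k * A k j = (v *m M) 0 j.
  by rewrite [RHS]mxE; apply: eq_bigr => k _; rewrite [in RHS]mxE.
by rewrite vM mxE scale0r.
Qed.

End lacunary_closure.

Theorem theorem1p3 (R : realType) (N : option nat) (hN : N <> Some 0%N) :
  exists E : set (bloch R), closed_invariant_subspace E /\ has_index E N.
Proof.
exists (lacunary_closure N); split; first exact: lacunary_closure_invariant.
have [basis basisP] := choice (@lacunary_bloch_exists R).
exact: lacunary_closure_index basisP N hN.
Qed.
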